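(* Let $\mathcal G$ be a class of (finite, undirected) graphs. The following four statements are equivalent. (1) $\mathcal G$ has structurally bounded expansion, i.e., there exist a graph class $\mathcal G'$ with bounded expansion and a first-order transduction $\tau$ such that $\mathcal G \subseteq \tau(\mathcal G')$. (2) There exists a function $f:\mathbb N\to\mathbb N$ such that every graph in $\mathcal G$ has a lacon-decomposition $(L,\pi)$ with $\mathrm{col}_r(L,\pi) \le f(r)$ for all $r \in \mathbb N$. (3) There exist a signature $S$, a number $d$ and a graph class $\mathcal G'$ with bounded expansion such that every graph in $\mathcal G$ has a shrub-decomposition $(F,S)$ with one color and diameter at most $d$ and with $F \in \mathcal G'$. (4) There exist a number $d$ and a graph class $\mathcal G'$ with bounded expansion such that every graph in $\mathcal G$ has a parity-decomposition $P \in \mathcal G'$ of target-degree at most $d$.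
   Context: A linear order on the vertices of a graph is an injective map $\pi: V\to\mathbb N$. For a graph $G$, order $\pi$ and vertices $u,v$: $u$ is $r$-reachable from $v$ if $\pi(u)\le\pi(v)$ and there is a path of length (number of edges) at most $r$ from $v$ to $u$ all of whose vertices $w$ satisfy $w=u$ or $\pi(w)\ge\pi(v)$. $\mathrm{reach}_r(G,\pi,v)$ is the set of vertices $r$-reachable from $v$ and $\mathrm{col}_r(G,\pi)=\max_v|\mathrm{reach}_r(G,\pi,v)|$. A graph class has bounded expansion if there is a function $f$ such that every graph $G$ in the class has an order $\pi$ with $\mathrm{col}_r(G,\pi)\le f(r)$ for all $r$. Lacon-decomposition: a pair $(L,\pi)$ where $L$ is a bipartite graph with sides $T$ (target vertices) and $H$ (hidden vertices), each hidden vertex is labeled ''0'' or ''1'', $\pi$ is a linear order on $V(L)$ with $\pi(h)<\pi(t)$ for all $h\in H,t\in T$, and for all $t,t'\in T$ we have $N(t)\cap N(t')\neq\emptyset$; the $\pi$-largest vertex of $N(t)\cap N(t')$ is the dominant vertex of $t,t'$. It is a lacon-decomposition of a graph $G$ if $V(G)=T$ and for all $t\ne t'\in T$, $tt'\in E(G)$ iff the dominant vertex of $t,t'$ is labeled ''1''. Shrub-decomposition of $m$ colors and diameter $d$ of a graph $G$: a pair $(F,S)$ with $F$ an undirected graph and $S\subseteq\{1,\dots,m\}^2\times\{1,\dots,d\}$ such that any two vertices of $F$ have distance at most $d$ in $F$, the set of degree-one vertices of $F$ is exactly $V(G)$, each degree-one vertex of $F$ is assigned a color in $\{1,\dots,m\}$,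 $(i,j,l)\in S$ iff $(j,i,l)\in S$, and for all $u,v\in V(G)$ with colors $i,j$ and $F$-distance $l$, $uv\in E(G)$ iff $(i,j,l)\in S$. Parity-decomposition of target-degree $d$ of a graph $G$: a bipartite graph $P$ with sides $T,H$ in which every vertex of $T$ has degree at most $d$, $T=V(G)$, and for all $t\ne t'\in T$, $tt'\in E(G)$ iff $|N(t)\cap N(t')|$ is odd. First-order transductions: a basic transduction is a triple $\tau_0=(\chi,\nu,\varphi)$ of first-order formulas with $0,1,2$ free variables; $\tau_0(G)$ is undefined if $G\not\models\chi$, otherwise it is the graph with vertex set $\{v: G\models\nu(v)\}$ and edges $uv$ ($u\neq v$) with $G\models\varphi(u,v)\lor\varphi(v,u)$. A $p$-parameter expansion maps $G$ to the set of all graphs obtained by adding $p$ unary predicates (colors) to $G$. An $m$-copy operation maps $G$ to the graph with vertex set $V(G)\times\{1,\dots,m\}$, edges $(v,i)(w,i)$ for $vw\in E(G)$, a binary relation $\sim$ with $(u,i)\sim(v,j)$ iff $u=v$, and unary predicates $Q_i=V(G)\times\{i\}$. A transduction is $\tau=\tau_0\circ\gamma\circ\varepsilon$ with $\varepsilon$ a parameter expansion, $\gamma$ a copy operation, $\tau_0$ a basic transduction; $\tau(\mathcal G')=\bigcup_{G\in\mathcal G'}\tau(G)$. *)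

(* Defs.v *)
(* MathComp. *)
From mathcomp Require Import all_boot.
Set Implicit Arguments.
Unset Strict Implicit.
Unset Printing Implicit Defensive.

Record sgraph := SGraph {
  vertex :> finType;
  edge : rel vertex;
  edge_sym : symmetric edge;
  edge_irr : irreflexive edge }.

Definition nbrs (G : sgraph) (x : G) : {set G} := [set y | edge x y].

Definition isomorphic (G H : sgraph) : Prop :=
  exists2 f : G -> H, bijective f & forall x y, edge (f x) (f y) = edge x y.

(* The vertices of the path are v :: p; its length is size p. *)
Definition is_path (G : sgraph) (v u : G) (p : seq G) : bool :=
  [&& path (@edge G) v p, uniq (v :: p) & last v p == u].

Definition dist_at_most (G : sgraph) (u v : G) (d : nat) : Prop :=
  exists2 p, is_path u v p & size p <= d.

Definition has_dist (G : sgraph) (u v : G) (l : nat) : Prop :=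
  (exists2 p, is_path u v p & size p = l) /\
  (forall p, is_path u v p -> l <= size p).

Definition reachable (G : sgraph) (r : nat) (pi : G -> nat) (v u : G) : bool :=
  (pi u <= pi v) &&
  [exists p : r.-bseq G,
     is_path v u p && all (fun w => (w == u) || (pi v <= pi w)) (v :: p)].

Definition reach (G : sgraph) (r : nat) (pi : G -> nat) (v : G) : {set G} :=
  [set u | reachable r pi v u].

Definition col (G : sgraph) (r : nat) (pi : G -> nat) : nat :=
  \max_(v : G) #|reach r pi v|.

Definition graph_class := sgraph -> Prop.

(* The order is chosen before r: one order serves all radii. *)
Definition bounded_expansion (C : graph_class) : Prop :=
  exists f : nat -> nat, forall G, C G ->
    exists2 pi : G -> nat, injective pi & forall r, col r pi <= f r.

(* Finite structures with unary symbols U and binary symbols B. *)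
Record structure (U B : Type) := Structure {
  dom :> finType;
  unary : U -> pred dom;
  binary : B -> rel dom }.

(* fo U B n: first-order formulas whose free variables are among 'I_n.
   FEx binds variable 0 of its body and shifts the others up by one. *)
Inductive fo (U B : Type) : nat -> Type :=
| FEq n (x y : 'I_n) : fo U B n
| FUn n (c : U) (x : 'I_n) : fo U B n
| FBin n (b : B) (x y : 'I_n) : fo U B n
| FNot n (f : fo U B n) : fo U B n
| FAnd n (f g : fo U B n) : fo U B n
| FEx n (f : fo U B n.+1) : fo U B n.

Fixpoint sat (U B : Type) (A : structure U B) (n : nat) (f : fo U B n) :
    n.-tuple A -> bool :=
  match f with
  | FEq _ x y => fun e => tnth e x == tnth e y
  | FUn _ c x => fun e => unary c (tnth e x)
  | FBin _ b x y => fun e => binary b (tnth e x) (tnth e y)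
  | FNot _ f => fun e => ~~ sat f e
  | FAnd _ f g => fun e => sat f e && sat g e
  | FEx _ f => fun e => [exists a : A, sat f [tuple of a :: e]]
  end.

Record basic_transduction (U B : Type) := BasicTransduction {
  chi : fo U B 0;
  nu : fo U B 1;
  phi : fo U B 2 }.

Section ApplyBasic.
Variables (U B : Type) (t : basic_transduction U B) (A : structure U B).

Definition basic_vertex : finType := {v : A | sat (nu t) [tuple v]}.

Definition basic_edge : rel basic_vertex := fun u v =>
  (u != v) && (sat (phi t) [tuple val u; val v] ||
               sat (phi t) [tuple val v; val u]).

Lemma basic_edge_sym : symmetric basic_edge.
Proof. by move=> u v; rewrite /basic_edge eq_sym orbC. Qed.

Lemma basic_edge_irr : irreflexive basic_edge.
Proof. by move=> u; rewrite /basic_edge eqxx. Qed.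

Definition basic_apply : option sgraph :=
  if sat (A := A) (chi t) [tuple] then Some (SGraph basic_edge_sym basic_edge_irr)
  else None.
End ApplyBasic.

Definition expand (p : nat) (G : sgraph) (c : 'I_p -> pred G) :
    structure 'I_p unit :=
  Structure c (fun=> @edge G).

(* In the m-copy, inl c is the symbol c of A, inr i is Q_i, Some b is the
   symbol b of A, and None is the relation ~. *)
Definition copy (U B : Type) (m : nat) (A : structure U B) :
    structure (U + 'I_m) (option B) :=
  @Structure (U + 'I_m)%type (option B) (A * 'I_m)%type
    (fun c x => match c with
                | inl c => unary c x.1
                | inr i => x.2 == i
                end)
    (fun b x y => match b with
                  | Some b => binary b x.1 y.1 && (x.2 == y.2)
                  | None => x.1 == y.1
                  end).

Record transduction := Transduction {
  nparams : nat;
  ncopies : nat;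
  ncopies_gt0 : 0 < ncopies;
  basic : basic_transduction ('I_nparams + 'I_ncopies) (option unit) }.

(* Membership in the image is up to isomorphism: the vertices produced by a
   transduction are pairs (v, i) with v a vertex of the input graph. *)
Definition transduce (tau : transduction) (C : graph_class) : graph_class :=
  fun H => exists2 G, C G & exists c : 'I_(nparams tau) -> pred G,
    exists2 H', basic_apply (basic tau) (copy (ncopies tau) (expand c)) = Some H'
              & isomorphic H' H.

Definition structurally_bounded_expansion (C : graph_class) : Prop :=
  exists C' : graph_class, bounded_expansion C' /\
  exists tau : transduction, forall G, C G -> transduce tau C' G.

(* The sides of L are T and its complement. *)
Definition bipartite (L : sgraph) (T : {set L}) : Prop :=
  forall x y : L, edge x y -> (x \in T) != (y \in T).

(* f realizes the equality V(G) = T. *)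
Definition identifies (G L : sgraph) (f : G -> L) (T : {set L}) : Prop :=
  injective f /\ f @: [set: G] = T.

Definition dominant (L : sgraph) (pi : L -> nat) (t t' h : L) : Prop :=
  h \in nbrs t :&: nbrs t' /\
  forall h', h' \in nbrs t :&: nbrs t' -> pi h' <= pi h.

(* Only the values of label on hidden vertices matter. *)
Definition lacon_decomposition (L : sgraph) (pi : L -> nat) (G : sgraph) : Prop :=
  exists (T : {set L}) (label : L -> bool) (f : G -> L),
    [/\ bipartite T,
        injective pi,
        forall h t, h \notin T -> t \in T -> pi h < pi t
      & forall t t', t \in T -> t' \in T -> nbrs t :&: nbrs t' != set0] /\
    identifies f T /\
    forall u v : G, u != v ->
      forall h, dominant pi (f u) (f v) h -> edge u v = label h.

(* Colors are 'I_m instead of {1, ..., m}; distances keep their value, hence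
   the bound 'I_d.+1 and the condition 0 < l. *)
Definition shrub_decomposition (m d : nat) (F : sgraph)
    (S : {set 'I_m * 'I_m * 'I_d.+1}) (G : sgraph) : Prop :=
  [/\ forall i j l, (i, j, l) \in S -> 0 < l,
      forall i j l, ((i, j, l) \in S) = ((j, i, l) \in S),
      forall x y : F, dist_at_most x y d
    & exists (f : G -> F) (color : G -> 'I_m),
        identifies f [set x | #|nbrs x| == 1] /\
        forall (u v : G) (l : 'I_d.+1), has_dist (f u) (f v) l ->
          edge u v = ((color u, color v, l) \in S)].

Definition parity_decomposition (d : nat) (P : sgraph) (G : sgraph) : Prop :=
  exists (T : {set P}) (f : G -> P),
    [/\ bipartite T,
        forall t, t \in T -> #|nbrs t| <= d,
        identifies f T
      & forall u v : G, u != v ->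
          edge u v = odd #|nbrs (f u) :&: nbrs (f v)|].

(* Main.v *)
(* From (1) to (2): in a graph with an order of bounded [col], weak reachability
   behaves like an ancestor relation. Two points weakly reachable from a common
   vertex are weakly reachable from one another, so a bounded set of "down
   functions" mapping each vertex to its weakly reachable points is closed under
   composition. By quantifier elimination, the truth of a formula depends only on
   vertex labels and on equalities between down functions of the arguments. For a
   quantifier over [y], let [w] be the largest point that [y] shares with the
   other arguments: what [y] shares with them is determined from [w], and what it
   must avoid is a set of bounded size, so a bounded number of representatives
   [y] per [w] suffices, and these can be described by labels. The edges of the
   transduced graph are thus determined by the largest common point of their ends
   and by the two views from it, which is what the hidden vertices record.

   From (2) to (3): replace the edge between a target and its hidden neighbor [h]
   by paths that are shorter for larger [h] and encode the label of [h] in the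
   parity of half the total length.

   From (2) to (4): take as hidden vertices the sets of hidden neighbors whose
   minimum is labeled 1. Among the nonempty subsets of a finite ordered set [M],
   an odd number has minimum [z] iff [z] is the maximum of [M].

   From (3) or (4) to (1): bounded distances, and parities of bounded sets, are
   first-order definable. *)
Require Import Defs.
From mathcomp Require Import all_boot.
From mathcomp Require Import zify.
Set Implicit Arguments.
Unset Strict Implicit.
Unset Printing Implicit Defensive.

(** * Reachability and projections *)

Lemma card_bigcup_leq (I T : finType) (P : pred I) (F : I -> {set T}) (C : nat) :
  (forall i, P i -> #|F i| <= C) -> #|\bigcup_(i | P i) F i| <= C * #|P|.
Proof.
move=> FC; rewrite mulnC -sum_nat_const.
elim/big_rec2: _ => [|i n A Pi le_An]; first by rewrite cards0.
by rewrite (leq_trans (leq_card_setU _ _)) // leq_add ?FC.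
Qed.

(** Walks serve as well as paths: shortening a walk to a path only drops vertices, so the length
    bound and the order condition survive. *)
Lemma reachP (G : sgraph) (r : nat) (pi : G -> nat) (v u : G) :
  reflect (pi u <= pi v /\ exists p, [/\ path (@edge G) v p, last v p = u,
             size p <= r & all (fun w => (w == u) || (pi v <= pi w)) (v :: p)])
          (u \in reach r pi v).
Proof.
rewrite inE; apply: (iffP andP) =>
  [[le_uv /existsP[p /andP[/and3P[pp _ /eqP lp] ap]]]|].
  by split=> //; exists p; split=> //; apply: size_bseq.
case=> le_uv [p [pp lp sp ap]]; split=> //.
case/shortenP: pp lp => q pq uq sub_q lq.
have sq : size q <= r.
  apply: leq_trans sp; case/andP: uq => _ uq; exact: uniq_leq_size uq sub_q.
apply/existsP; exists (Bseq sq); rewrite /is_path uq pq lq eqxx /=.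
rewrite leqnn orbT; apply/allP => w /sub_q wp.
by move/allP: ap; apply; rewrite inE wp orbT.
Qed.

Lemma reach_col (G : sgraph) (r : nat) (pi : G -> nat) (v : G) :
  #|reach r pi v| <= col r pi.
Proof. by rewrite /col (bigmax_sup v). Qed.

(* If the order on [F] refines the order on [L] along a weak homomorphism, then
   a witness of reachability in [F] projects to one in [L]; only the fibres can
   make reachability sets larger. *)
Lemma col_weak_hom (F L : sgraph) (h : F -> L) (piF : F -> nat) (piL : L -> nat)
    (C r : nat) :
  (forall x y, edge x y -> h x = h y \/ edge (h x) (h y)) ->
  (forall x y, piF x <= piF y -> piL (h x) <= piL (h y)) ->
  (forall z, #|[set x | (h x == z) && (nbrs x != set0)]| <= C) ->
  col r piF <= (C * col r piL).+1.
Proof.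
move=> hom mono fib; apply/bigmax_leqP => v _.
have sub : reach r piF v \subset v |: \bigcup_(z in reach r piL (h v))
    [set x | (h x == z) && (nbrs x != set0)].
  apply/subsetP => u /reachP[le_uv [p [pp lp sp ap]]].
  (* Any reached [u] other than [v] ends a nonempty walk, hence has a neighbor and is counted in the
     fibre over [h u]; [v] itself accounts for the successor in the bound. *)
  rewrite !inE; case: eqVneq => //= neq_uv.
  apply/bigcupP; exists (h u); last first.
    rewrite inE eqxx; case/lastP: p pp lp {sp ap} => [|p w] /=.
      by move=> _ uv; rewrite uv eqxx in neq_uv.
    rewrite rcons_path last_rcons => /andP[_ e] wu.
    apply/set0Pn; exists (last v p); rewrite inE edge_sym -wu //.
  apply/reachP; split; first exact: mono.
  suff [q [pq lq sq aq]]: exists q, [/\ path (@edge L) (h v) q, last (h v) q = h u,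
      size q <= size p & {subset q <= map h (v :: p)}].
    exists q; split=> //; first exact: leq_trans sp.
    rewrite /= leqnn orbT; apply/allP => w /aq/mapP[x xp ->].
    move/allP: ap => /(_ _ xp)/orP[/eqP->|/mono->]; by rewrite ?eqxx ?orbT.
  move: {neq_uv le_uv sp ap} v pp lp; elim: p => [|x p IH] v /=.
    by move=> _ <-; exists [::].
  case/andP=> vx px lp; have [q [pq lq sq aq]] := IH x px lp.
  case: (hom _ _ vx) => [->|e].
    exists q; split=> //; first exact: leqW.
    by move=> w /aq; rewrite !inE => /orP[->|->]; rewrite ?orbT.
  exists (h x :: q); split=> //=; first by rewrite e.
  by move=> w; rewrite !inE => /orP[->|/aq]; rewrite ?orbT // !inE => /orP[->|->];
    rewrite ?orbT.
apply: (leq_trans (subset_leq_card sub)).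
apply: (leq_trans (leq_card_setU _ _)); rewrite cards1 add1n ltnS.
apply: leq_trans (card_bigcup_leq (fun z _ => fib z)) _.
by rewrite leq_mul2l reach_col orbT.
Qed.

(** Lexicographic tie-breaking: the rank is below [#|X|], so any key is refined to an injective
    order. *)
Definition refine (X : finType) (k : X -> nat) (x : X) : nat :=
  k x * #|X| + enum_rank x.

Lemma refine_mono (X : finType) (k : X -> nat) (x y : X) :
  refine k x <= refine k y -> k x <= k y.
Proof.
apply: contraTT; rewrite -!ltnNge /refine => lt_yx.
apply: (@leq_trans ((k y).+1 * #|X|)); first by rewrite mulSnr ltn_add2l.
by rewrite (leq_trans _ (leq_addr _ _)) // leq_mul2r lt_yx orbT.
Qed.

Lemma refine_inj (X : finType) (k : X -> nat) : injective (refine k).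
Proof.
move=> x y eq_xy; have kE: k x = k y.
  by apply/eqP; rewrite eqn_leq !(@refine_mono _ k) ?eq_xy.
by move: eq_xy; rewrite /refine kE => /addnI/ord_inj/enum_rank_inj.
Qed.

(** * Weak reachability *)

(** Weak reachability: [v] is the smallest vertex of a walk of length at most [r] from [u]. *)
Fixpoint wreach (G : sgraph) (pi : G -> nat) (r : nat) (u v : G) : bool :=
  if r is r'.+1 then
    (pi v <= pi u) && ((u == v) || [exists w, edge u w && wreach pi r' w v])
  else u == v.

Section WeakReachability.
Variables (G : sgraph) (pi : G -> nat).
Implicit Types u v w : G.

Lemma wreach_refl r u : wreach pi r u u.
Proof. by case: r => [|r] /=; rewrite ?leqnn eqxx. Qed.

Lemma wreach_leq r u v : wreach pi r u v -> pi v <= pi u.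
Proof. by case: r => [/eqP->//|r /andP[]]. Qed.

Lemma wreach_mono r s u v : r <= s -> wreach pi r u v -> wreach pi s u v.
Proof.
elim: r s u => [|r IH] [|s] u //=; rewrite ?ltnS.
  by move=> _ /eqP->; rewrite leqnn eqxx.
move=> rs /andP[-> /orP[->//|/existsP[w /andP[e p]]]]; apply/orP; right.
by apply/existsP; exists w; rewrite e IH.
Qed.

Lemma wreach_trans r s u v w :
  wreach pi r u v -> wreach pi s v w -> wreach pi (r + s) u w.
Proof.
elim: r u => [|r IH] u /=; first by move/eqP->.
case/andP=> vu H vw; rewrite (leq_trans (wreach_leq vw) vu) /=.
case/orP: H => [/eqP->|/existsP[x /andP[e xv]]].
  by have := wreach_mono (leq_addl r.+1 s) vw; rewrite addSn /= => /andP[].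
by apply/orP; right; apply/existsP; exists x; rewrite e IH.
Qed.

(** Reverse the walk to [w] and append the walk to [v]: the first part stays above [w], hence above
    [v]. The induction moves the start [u] one step along its walk to [w]. *)
Lemma wreach_fraternal r s u v w :
  wreach pi r u v -> wreach pi s u w -> pi v <= pi w -> wreach pi (r + s) w v.
Proof.
elim: s r u => [|s IH] r u uv /=.
  by move/eqP=> <- _; rewrite addn0.
case/andP=> wu /orP[/eqP<- _|/existsP[x /andP[e xw]] vw].
  by apply: wreach_mono uv; apply: leq_addr.
rewrite addnS -addSn; apply: (IH _ x) (xw) (vw) => /=.
rewrite (leq_trans vw (wreach_leq xw)) /=; apply/orP; right.
by apply/existsP; exists u; rewrite edge_sym e.
Qed.

Lemma wreach1 u v : pi v <= pi u -> edge u v -> wreach pi 1 u v.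
Proof.
by move=> vu e /=; rewrite vu; apply/orP; right; apply/existsP; exists v;
  rewrite e eqxx.
Qed.

Hypothesis pi_inj : injective pi.

(** Take the first vertex below [u] on the walk to [v]. At least one step is spent on reaching it,
    so weak reachability sets can be bounded by induction on the radius. *)
Lemma wreach_first r u v : wreach pi r u v -> v != u ->
  0 < r /\ exists2 x, x \in reach r pi u & wreach pi r.-1 x v.
Proof.
(* [p] is the part of the walk already traversed, all of it at or above [u], and [w] is its current
   end. *)
suff gen s p w : path (@edge G) u p -> last u p = w ->
    all (fun z => pi u <= pi z) (u :: p) -> pi v < pi u -> wreach pi s w v ->
    0 < s /\ exists2 x, x \in reach (size p + s) pi u & wreach pi s.-1 x v.
  move=> uv neq_uv; apply: (gen r [::] u) => //=; first by rewrite leqnn.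
  rewrite ltn_neqAle (wreach_leq uv) andbT.
  by apply: contraNN neq_uv => /eqP/pi_inj->.
elim: s p w => [|s IH] p w pp lp ap vu /=.
  move/eqP=> wv; move: ap; rewrite -wv -lp in vu *.
  by move/allP/(_ _ (mem_last u p)); rewrite leqNgt vu.
case/andP=> _ /orP[/eqP wv|/existsP[x /andP[e xv]]].
  move: ap; rewrite -wv -lp in vu *.
  by move/allP/(_ _ (mem_last u p)); rewrite leqNgt vu.
split=> //; have [le_ux|lt_xu] := leqP (pi u) (pi x); last first.
  exists x => //; apply/reachP; split; first exact: ltnW.
  exists (rcons p x); rewrite rcons_path pp lp e last_rcons size_rcons.
  split=> //; first by rewrite addnS ltnS leq_addr.
  rewrite -rcons_cons all_rcons eqxx /=; apply/andP; split; first by rewrite leqnn orbT.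
  by case/andP: ap => _ /allP ap; apply/allP => z /ap->; rewrite orbT.
have [|||s0 [y y1 y2]] := IH (rcons p x) x _ _ _ vu xv.
- by rewrite rcons_path pp lp.
- by rewrite last_rcons.
- by rewrite -rcons_cons all_rcons le_ux.
exists y; first by rewrite addnS -addSn -(size_rcons p x).
by apply: wreach_mono y2; apply: leq_pred.
Qed.

End WeakReachability.

Fixpoint wcol_bound (f : nat -> nat) (r : nat) : nat :=
  if r is r'.+1 then (wcol_bound f r' * f r).+1 else 1.

Lemma wreach_card (G : sgraph) (pi : G -> nat) (f : nat -> nat) (r : nat) (u : G) :
  injective pi -> (forall r, col r pi <= f r) ->
  #|[set v | wreach pi r u v]| <= wcol_bound f r.
Proof.
move=> pi_inj colf; elim: r u => [|r IH] u /=.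
  by rewrite -(cards1 u) subset_leq_card //; apply/subsetP=> v; rewrite !inE eq_sym.
have sub : [set v | wreach pi r.+1 u v] \subset
    u |: \bigcup_(x in reach r.+1 pi u) [set v | wreach pi r x v].
  apply/subsetP => v; rewrite [in X in X -> _]inE => uv; rewrite !inE;
    case: eqVneq => //= neq.
  have [_ [x xr xv]] := wreach_first pi_inj uv neq.
  by apply/bigcupP; exists x; rewrite // inE.
apply: leq_trans (subset_leq_card sub) _.
apply: leq_trans (leq_card_setU _ _) _; rewrite cards1 add1n ltnS.
apply: leq_trans (card_bigcup_leq (fun x _ => IH x)) _.
by rewrite leq_mul2l (leq_trans (reach_col _ _ _)) ?orbT.
Qed.

(* The points of a graph with a linear order, completed by a bottom point that
   every point reaches; [wr r u v] is weak [r]-reachability of [v] from [u].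
   Because a single order serves all radii, this family of relations is closed
   under transitivity and fraternity. *)
Record wsystem (N : nat -> nat) := WSystem {
  point : finType;
  key : point -> nat;
  wr : nat -> rel point;
  bot : point;
  key_inj : injective key;
  wr_refl : forall r u, wr r u u;
  wr_leq : forall r u v, wr r u v -> key v <= key u;
  wr_trans : forall r s u v w, wr r u v -> wr s v w -> wr (r + s) u w;
  wr_frat : forall r s u v w,
    wr r u v -> wr s u w -> key v <= key w -> wr (r + s) w v;
  wr_card : forall r u, #|[set v | wr r u v]| <= N r;
  wr_bot : forall r u, wr r u bot }.

Section GraphSystem.
Variables (G : sgraph) (pi : G -> nat) (f : nat -> nat).
Hypothesis (pi_inj : injective pi) (colf : forall r, col r pi <= f r).

Definition okey (u : option G) : nat := if u is Some x then (pi x).+1 else 0.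

Definition owr (r : nat) (u v : option G) : bool :=
  match u, v with
  | _, None => true
  | None, Some _ => false
  | Some x, Some y => wreach pi r x y
  end.

Fact okey_inj : injective okey.
Proof. by move=> [x|] [y|] //= [] /pi_inj->. Qed.

Fact owr_refl r u : owr r u u.
Proof. by case: u => //= x; apply: wreach_refl. Qed.

Fact owr_leq r u v : owr r u v -> okey v <= okey u.
Proof. by case: u v => [x|] [y|] //=; apply: wreach_leq. Qed.

Fact owr_trans r s u v w : owr r u v -> owr s v w -> owr (r + s) u w.
Proof. by case: u v w => [x|] [y|] [z|] //=; apply: wreach_trans. Qed.

Fact owr_frat r s u v w :
  owr r u v -> owr s u w -> okey v <= okey w -> owr (r + s) w v.
Proof. by case: u v w => [x|] [y|] [z|] //=; apply: wreach_fraternal. Qed.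

Fact owr_card r u : #|[set v | owr r u v]| <= (wcol_bound f r).+1.
Proof.
case: u => [x|].
  rewrite (cardsD1 None) inE /= ltnS.
  apply: leq_trans (wreach_card r x pi_inj colf).
  rewrite -(card_imset _ Some_inj) subset_leq_card //.
  apply/subsetP => -[y|]; rewrite !inE //= => xy.
  by apply: imset_f; rewrite inE.
rewrite (@leq_trans 1) // -(cards1 (@None G)) subset_leq_card //.
by apply/subsetP => -[y|]; rewrite !inE.
Qed.

Fact owr_bot r u : owr r u None.
Proof. by case: u. Qed.

Definition graph_system : wsystem (fun r => (wcol_bound f r).+1) :=
  WSystem okey_inj owr_refl owr_leq owr_trans owr_frat owr_card owr_bot.
End GraphSystem.

(** The default [u] of [nth] keeps the value weakly reachable for every index. The index [None]
    names the point itself uniformly. *)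
Definition down N (S : wsystem N) (r : nat) (i : option 'I_(N r)) (u : point S) :
    point S :=
  if i is Some i then nth u (enum [set v | wr r u v]) i else u.

Lemma down_wr N (S : wsystem N) (r : nat) (i : option 'I_(N r)) (u : point S) :
  wr r u (down i u).
Proof.
case: i => [i|] /=; last exact: wr_refl.
have [lt|ge] := ltnP i (size (enum [set v | wr r u v])).
  by have:= mem_nth u lt; rewrite mem_enum inE.
by rewrite nth_default // wr_refl.
Qed.

Lemma down_surj N (S : wsystem N) (r : nat) (u v : point S) :
  wr r u v -> exists i : option 'I_(N r), down i u = v.
Proof.
move=> uv; have lt : index v (enum [set v | wr r u v]) < N r.
  apply: leq_trans (wr_card r u); rewrite cardE index_mem mem_enum inE //.
by exists (Some (Ordinal lt)); rewrite /= nth_index // mem_enum inE.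
Qed.

(** * Representatives *)

Section Kernel.
Variables (A W I : finType) (a : I -> A -> W) (P : {set I}).
Implicit Types (Y : {set A}) (X : {set W}).

Fixpoint kernel_size (k n : nat) : nat :=
  if n is n'.+1 then (kernel_size k n' * k).+1 else 1.

(* A member of [Y] all of whose coordinates in [P] avoid a set [X] of at most
   [n] points can be found in [kernel n Y]: either the chosen [y0] avoids [X], or
   [X] contains some [a p y0], and one recurses on the members avoiding [a p y0]
   with one forbidden point less. *)
Fixpoint kernel (n : nat) (Y : {set A}) : {set A} :=
  if [pick y in Y] is Some y0 then
    y0 |: (if n is n'.+1 then
             \bigcup_(p in P)
               kernel n' [set y in Y | [forall q in P, a q y != a p y0]]
           else set0)
  else set0.

Lemma kernel_sub n Y : kernel n Y \subset Y.
Proof.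
elim: n Y => [|n IH] Y /=; case: pickP => [y0 Yy0|_]; rewrite ?sub0set //.
  by rewrite setU0 sub1set.
rewrite subUset sub1set Yy0; apply/bigcupsP => p _.
by apply: subset_trans (IH _) _; apply/subsetP => y; rewrite inE => /andP[].
Qed.

Lemma kernel_card n Y : #|kernel n Y| <= kernel_size #|I| n.
Proof.
elim: n Y => [|n IH] Y /=; case: pickP => [y0 Yy0|_]; rewrite ?cards0 //.
  by rewrite setU0 cards1.
rewrite (leq_trans (leq_card_setU _ _)) // cards1 add1n ltnS.
apply: leq_trans (card_bigcup_leq (fun p _ => IH _)) _.
by rewrite leq_mul2l max_card orbT.
Qed.

Lemma kernelP n Y (X : {set W}) y : #|X| <= n -> y \in Y ->
  (forall p, p \in P -> a p y \notin X) ->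
  exists2 y0, y0 \in kernel n Y & forall p, p \in P -> a p y0 \notin X.
Proof.
elim: n X Y => [|n IH] X Y Xn Yy avoid /=; case: pickP => [y0 Yy0|/(_ y)];
  rewrite ?Yy //.
  move: Xn; rewrite leqn0 cards_eq0 => /eqP->.
  by exists y0 => [|p _]; rewrite inE ?set11.
have [/forall_inP av0|] := boolP [forall p in P, a p y0 \notin X].
  by exists y0 => //; rewrite setU11.
case/forall_inPn => p Pp; rewrite negbK => Xp.
have [||q Pq|y1 y1P av1] := IH (X :\ a p y0) [set y in Y | [forall q in P, a q y !=
  a p y0]].
- by move: Xn; rewrite (cardsD1 (a p y0)) Xp.
- rewrite inE Yy; apply/forall_inP => q Pq.
  by apply: contraNneq (avoid q Pq) => ->.
- by rewrite inE negb_and avoid ?orbT.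
exists y1; first by rewrite inE; apply/orP; right; apply/bigcupP; exists p.
move=> q Pq; have := av1 q Pq; rewrite !inE negb_and negbK => /orP[/eqP e|//].
have /(subsetP (kernel_sub _ _)) := y1P; rewrite inE => /andP[_ /forall_inP/(_ q Pq)].
by rewrite e eqxx.
Qed.

End Kernel.

Section Extension.
Variables (N : nat -> nat) (S : wsystem N) (A I L : finType) (r n : nat).
Variables (base : A -> point S) (a : I -> A -> point S) (lam : A -> L).
Hypothesis a_wr : forall p y, wr r (base y) (a p y).

Local Notation dn := (@down N S (r + r)).

Definition view_type : finType :=
  (L * {set I * I} * {set I * option 'I_(N (r + r))})%type.

Definition view (w : point S) (y : A) : view_type :=
  (lam y, [set pq | a pq.1 y == a pq.2 y], [set pi | a pi.1 y == dn pi.2 w]).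

Lemma view_lam w w' y y' : view w y = view w' y' -> lam y = lam y'.
Proof. by case. Qed.

Lemma view_eq w w' y y' p q : view w y = view w' y' ->
  (a p y == a q y) = (a p y' == a q y').
Proof. by case=> _ /setP/(_ (p, q)) + _; rewrite !inE. Qed.

Lemma view_down w w' y y' p i : view w y = view w' y' ->
  (a p y == dn i w) = (a p y' == dn i w').
Proof. by case=> _ _ /setP/(_ (p, i)); rewrite !inE. Qed.

(** Fraternity below [base y]; this is why down functions have radius [r + r]. The view of [y] from
    one of its own coordinates thus determines all smaller coordinates. *)
Lemma coord_down p q y : key (a q y) <= key (a p y) ->
  exists i : option 'I_(N (r + r)), dn i (a p y) = a q y.
Proof. by move=> le; apply/down_surj/(wr_frat (a_wr q y) (a_wr p y)). Qed.

Definition slot_type : finType :=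
  (view_type * {set I} * 'I_(kernel_size #|I| n))%type.

(* The [s]-th representative of the elements whose view from [w] is [v], the
   coordinates in [P] being those that must avoid forbidden points. *)
Definition repr (c : slot_type) (w : point S) : option A :=
  let: (v, P, s) := c in
  nth None [seq Some y | y <- enum (kernel a P n [set y | view w y == v])] s.

Definition info_type : finType :=
  {ffun slot_type -> bool * {set I * option 'I_(N (r + r))}}.

(** A representative chosen at a point below [w] may have [w] among its coordinates. This is not
    visible from the smaller point, so the second component records it at [w]. *)
Definition info (w : point S) : info_type :=
  [ffun c => (repr c w : bool,
    [set pi | if repr c (dn pi.2 w) is Some y then a pi.1 y == w else false])].

Lemma repr_view v P s w y : repr (v, P, s) w = Some y -> view w y = v.
Proof.
move=> /= rE; set K := kernel _ _ _ _ in rE.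
have lt : s < size (enum K).
  by rewrite ltnNge; apply/negP => ge; rewrite nth_default ?size_map in rE.
move: rE; rewrite (nth_map y) // => -[yE].
have /(subsetP (kernel_sub _ _ _ _)) : y \in K by rewrite -mem_enum -yE mem_nth.
by rewrite inE => /eqP.
Qed.

Lemma repr_surj v P w y : y \in kernel a P n [set y | view w y == v] ->
  exists s, repr (v, P, s) w = Some y.
Proof.
set K := kernel _ _ _ _ => yK.
have ltK : index y (enum K) < size (enum K) by rewrite index_mem mem_enum.
have lt : index y (enum K) < kernel_size #|I| n.
  by apply: leq_trans ltK _; rewrite -cardE kernel_card.
by exists (Ordinal lt); rewrite /= (nth_map y) // nth_index // mem_enum.
Qed.

(** The back-and-forth step that eliminates a quantifier. With [x j] the largest point that [y]
    shares with the family, a representative [y0] at [x j] has the view of [y] and avoids the family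
    on the unshared coordinates; [y'] is the representative in the same slot at [x' j]. *)
Lemma extension (J : finType) (x x' : J -> point S) (p0 : I) (j0 : J) :
  #|J| <= n -> (forall y, a p0 y = x j0) ->
  (forall j, info (x j) = info (x' j)) ->
  (forall i j j', (dn i (x j) == x j') = (dn i (x' j) == x' j')) ->
  forall y, exists y', [/\ lam y = lam y',
    forall p q, (a p y == a q y) = (a p y' == a q y') &
    forall p j, (a p y == x j) = (a p y' == x' j)].
Proof.
move=> Jn a0 xinfo xdown y.
pose com : {set I} := [set p | [exists j, a p y == x j]].
have [p com_p max_p] : exists2 p, p \in com & forall q, q \in com -> key (a q y) <=
  key (a p y).
  have com0 : p0 \in com by rewrite inE; apply/existsP; exists j0; rewrite a0.
  by case: (@arg_maxnP _ p0 (mem com) (fun q => key (a q y))) => // p; exists p.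
have [j wE] : exists j, a p y = x j by move: com_p;
  rewrite inE => /existsP[j /eqP]; exists j.
have XN : #|[set x j | j : J]| <= n by rewrite (leq_trans (leq_imset_card _ _)).
have [||y0 y0K av] := kernelP (P := ~: com) (a := a) (y := y) (Y := [set z | view
  (x j) z == view (x j) y]) XN.
- by rewrite inE.
- move=> q; rewrite !inE negb_exists => /forallP ncom.
  by apply/imsetP => -[j' _ /eqP]; apply/negP.
have [s sE] := repr_surj y0K; have v0 := repr_view sE.
set c := (_, _, s) in sE.
have [y' s'E] : exists y', repr c (x' j) = Some y'.
  have := congr1 (fun g : info_type => (g c).1) (xinfo j).
  by rewrite !ffunE sE; case: (repr c (x' j)) => // y' _; exists y'.
have v' := repr_view s'E; clearbody c; exists y'; split.
- by rewrite (view_lam v').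
- by move=> p1 q1; rewrite (view_eq _ _ v').
have wE0 : a p y0 = x j by apply/eqP;
  rewrite -[x j]/(dn None (x j)) (view_down _ _ v0) wE.
have wE' : a p y' = x' j by apply/eqP;
  rewrite -[x' j]/(dn None (x' j)) (view_down _ _ v') wE.
move=> q j'; have [qcom|nqcom] := boolP (q \in com).
  have [i iE] := coord_down (max_p q qcom); rewrite wE in iE.
  have /eqP -> : a q y' == dn i (x' j) by rewrite (view_down _ _ v') iE.
  by rewrite -iE xdown.
have -> : (a q y == x j') = false.
  by apply: contraNF nqcom => e; rewrite inE; apply/existsP; exists j'.
(* An unwanted coincidence of [y'] with [x' j'] is transferred back to [y0], which avoids [x j'] at
   [q]. *)
apply/esym/eqP => zE.
have : a q y0 != x j'.
  by apply: contraNneq (av q _) => [->|]; rewrite ?imset_f // inE.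
case/negP; have [le|/ltnW le] := leqP (key (a q y')) (key (a p y')).
  have [i iE] := coord_down le; rewrite wE' in iE.
  have /eqP -> : a q y0 == dn i (x j) by rewrite (view_down _ _ v0) -(view_down _ _
    v') iE.
  by rewrite xdown iE zE.
(* Now [x' j'] lies above [x' j], which is therefore one of its down points; the second component of
   [info] at [x' j'] has recorded the coincidence. *)
have [i iE] := coord_down le; rewrite wE' zE in iE.
have /setP/(_ (q, i)) := congr1 (fun g : info_type => (g c).2) (xinfo j').
rewrite !ffunE !inE /= iE s'E zE eqxx.
have /eqP -> : dn i (x j') == x j by rewrite xdown iE.
by rewrite sE.
Qed.

End Extension.

(** * Quantifier elimination *)

(* [P] depends only on finitely many labels and on the equalities between
   finitely many points that are weakly [r]-reachable from the arguments. *)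
Definition determined N (S : wsystem N) (A : finType) (base : A -> point S)
    (r : nat) (I L : finType) (n : nat) (P : n.-tuple A -> bool) : Prop :=
  exists (a : I -> A -> point S) (lam : A -> L),
    [/\ forall p y, wr r (base y) (a p y),
        exists p0, forall y, a p0 y = bot S
      & forall e e' : n.-tuple A,
          (forall i, lam (tnth e i) = lam (tnth e' i)) ->
          (forall i j p q, (a p (tnth e i) == a q (tnth e j)) =
                           (a p (tnth e' i) == a q (tnth e' j))) ->
          P e = P e'].

Section Determined.
Variables (N : nat -> nat) (S : wsystem N) (A : finType) (base : A -> point S).

Lemma wr_addr r s (u v : point S) : wr r u v -> wr (r + s) u v.
Proof. by move=> uv; apply: wr_trans uv (wr_refl _ _). Qed.

Lemma down_bot r (i : option 'I_(N r)) : down i (bot S) = bot S.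
Proof.
apply: key_inj; apply/eqP; rewrite eqn_leq (wr_leq (down_wr i _)) /=.
exact: wr_leq (wr_bot 0 _).
Qed.

Lemma determined_not r I L n (P : n.-tuple A -> bool) :
  determined base r I L P -> determined base r I L (fun e => ~~ P e).
Proof.
move=> [a [lam [a_wr a_bot aP]]]; exists a, lam; split=> // e e' el ea.
by rewrite (aP _ _ el ea).
Qed.

Lemma determined_and r1 r2 I1 I2 L1 L2 n (P1 P2 : n.-tuple A -> bool) :
  determined base r1 I1 L1 P1 -> determined base r2 I2 L2 P2 ->
  determined base (r1 + r2) (I1 + I2)%type (L1 * L2)%type (fun e => P1 e && P2 e).
Proof.
move=> [a1 [lam1 [w1 [p0 b1] d1]]] [a2 [lam2 [w2 _ d2]]].
exists (fun p y => match p with inl p => a1 p y | inr p => a2 p y end).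
exists (fun y => (lam1 y, lam2 y)); split.
- by case=> p y; [|rewrite addnC]; apply: wr_addr.
- by exists (inl p0).
move=> e e' el ea; congr (_ && _).
  apply: d1 => [i|i j p q]; first by case: (el i).
  exact: (ea i j (inl p) (inl q)).
apply: d2 => [i|i j p q]; first by case: (el i).
exact: (ea i j (inr p) (inr q)).
Qed.

(** The coordinates are closed under down functions of radius [r + r], and the labels also store
    [info] at each old coordinate: exactly the hypotheses of [extension]. *)
Lemma determined_ex r (I L : finType) n (P : n.+1.-tuple A -> bool) :
  determined base r I L P ->
  determined base (r + (r + r)) (option 'I_(N (r + r)) * I)%type
    (L * {ffun I -> info_type N I L r #|{: option ('I_n * I)}|})%type
    (fun e => [exists x, P [tuple of x :: e]]).
Proof.
move=> [a [lam [a_wr [p0 a_bot] aP]]].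
pose k := #|{: option ('I_n * I)}|.
exists (fun p y => down p.1 (a p.2 y)).
exists (fun y => (lam y, [ffun p => @info N S A I L r k a lam (a p y)])); split.
- by move=> p y; apply: wr_trans (a_wr _ _) (down_wr _ _).
- by exists (None, p0).
suff half (e e' : n.-tuple A) :
    (forall i, (lam (tnth e i), [ffun p =>
      @info N S A I L r k a lam (a p (tnth e i))]) =
      (lam (tnth e' i), [ffun p => @info N S A I L r k a lam (a p (tnth e' i))])) ->
    (forall i j (p q : option 'I_(N (r + r)) * I),
      (down p.1 (a p.2 (tnth e i)) == down q.1 (a q.2 (tnth e j))) =
      (down p.1 (a p.2 (tnth e' i)) == down q.1 (a q.2 (tnth e' j)))) ->
    [exists x, P [tuple of x :: e]] -> [exists x, P [tuple of x :: e']].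
  move=> e e' el ea; apply/idP/idP; first exact: half el ea.
  by apply: half => [i|i j p q]; [rewrite el|rewrite ea].
move=> el ea /existsP[y Py].
(* The index [None] contributes the bottom point, so that [y] shares a point with the family even if
   [n = 0]. *)
pose x (e : n.-tuple A) (j : option ('I_n * I)) :=
  if j is Some (i, q) then a q (tnth e i) else bot S.
have [j|i j j'|y' [laml yy yx]] := @extension N S A I L r k base a lam a_wr
    _ (x e) (x e') p0 None (leqnn _) a_bot _ _ y.
- case: j => [[i q]|] //=; case: (el i) => _ /ffunP/(_ q).
  by rewrite !ffunE.
- case: j j' => [[i1 q]|] [[i2 q']|] /=.
  + exact: (ea i1 i2 (i, q) (None, q')).
  + have := ea i1 i1 (i, q) (None, p0); by rewrite /= !a_bot.
  + have := ea i2 i2 (None, p0) (None, q'); by rewrite /= !a_bot !down_bot.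
  + by rewrite !down_bot !eqxx.
apply/existsP; exists y'; rewrite -(aP [tuple of y :: e]) //.
- move=> i; case: (unliftP ord0 i) => [i'|] ->; rewrite ?tnthS ?tnth0 //.
  by case: (el i').
- move=> i j p q; case: (unliftP ord0 i) => [i'|] ->;
  case: (unliftP ord0 j) => [j'|] ->;
    rewrite ?tnthS ?tnth0 //.
  + exact: (ea i' j' (None, p) (None, q)).
  + by rewrite ![a p _ == _]eq_sym; apply: (yx q (Some (i', p))).
  + exact: (yx p (Some (j', q))).
Qed.

End Determined.

Section QuantifierElimination.
Variables (p m : nat) (f : nat -> nat).

(** The radius and the two index types depend on the formula and on [f] but not on the graph, which
    makes the later bounds uniform over a class. All copies of a vertex have the same base point;
    labels tell them apart. *)
Theorem sat_determined n (phi : fo ('I_p + 'I_m) (option unit) n) :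
  exists (r : nat) (I L : finType), forall (G : sgraph) (pi : G -> nat)
      (pi_inj : injective pi) (colf : forall r, col r pi <= f r)
      (c : 'I_p -> pred G),
    @determined _ (graph_system pi_inj colf) (copy m (expand c))
      (fun y => Some y.1) r I L n (@sat _ _ (copy m (expand c)) n phi).
Proof.
elim: n / phi => [n x y|n u x|n b x y|n phi [r [I [L IH]]]|n phi [r1 [I1 [L1 IH1]]]
  psi [r2 [I2 [L2 IH2]]]|n phi [r [I [L IH]]]].
- exists 0, bool, (ordinal m) => G pi pi_inj colf c.
  exists (fun b y => if b then Some y.1 else None), snd; split=> //.
  + by move=> [] y' //=; rewrite eqxx.
  + by exists false.
  move=> e e' el ea /=; rewrite -!pair_eqE /pair_eq !el; congr (_ && _).
  exact: (ea x y true true).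
- exists 0, unit, bool => G pi pi_inj colf c.
  exists (fun _ _ => None), (@unary _ _ (copy m (expand c)) u); split=> //.
  by move=> e e' el _ /=; apply: el.
- case: b => [[]|].
    exists 1, (option (option (ordinal (wcol_bound f 1).+1))), (ordinal m) =>
      G pi pi_inj colf c.
    set S := graph_system pi_inj colf.
    exists (fun i y => if i is Some i then @down _ S 1 i (Some y.1) else None), snd.
    (* Two distinct vertices are adjacent exactly when the larger weakly 1-reaches the smaller,
       which is an equality of down functions. *)
    have edgeE (v w : G) : edge v w = (@down _ S 1 None (Some v) != @down _ S 1
      None (Some w)) &&
        [exists i : option 'I_(wcol_bound f 1).+1,
           (@down _ S 1 i (Some v) == @down _ S 1 None (Some w)) ||
           (@down _ S 1 None (Some v) == @down _ S 1 i (Some w))].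
      apply/idP/andP => [vw|[neq /existsP[i]]].
        split; first by apply: contraTneq vw => -[->]; rewrite edge_irr.
        apply/existsP; have [le|/ltnW le] := leqP (pi w) (pi v).
          have [i <-] := @down_surj _ S 1 (Some v) (Some w) (wreach1 le vw).
          by exists i; rewrite eqxx.
        rewrite edge_sym in vw.
        have [i <-] := @down_surj _ S 1 (Some w) (Some v) (wreach1 le vw).
        by exists i; rewrite eqxx orbT.
      have wr1 (a b : G) : Some a != Some b -> wreach pi 1 a b -> edge a b.
        rewrite /= => nab /andP[_ /orP[/eqP ab|/existsP[z /andP[az /eqP<-]]]] //.
        by rewrite ab eqxx in nab.
      case/orP=> /eqP iE.
        by apply: wr1 => //; have := down_wr (S := S) i (Some v); rewrite iE.
      rewrite edge_sym; apply: wr1; first by rewrite eq_sym.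
      by have := down_wr (S := S) i (Some w); rewrite -iE.
    split=> //.
    + by case=> [i|] y' //; apply: down_wr.
    + by exists None.
    move=> e e' el ea; rewrite /= !el; congr (_ && _); rewrite !edgeE.
    rewrite (ea x y (Some None) (Some None)); congr (_ && _).
    apply: eq_existsb => i; congr (_ || _).
      exact: (ea x y (Some i) (Some None)).
    exact: (ea x y (Some None) (Some i)).
  exists 0, bool, unit => G pi pi_inj colf c.
  exists (fun b y => if b then Some y.1 else None), (fun=> tt); split=> //.
  + by move=> [] y' //=; rewrite eqxx.
  + by exists false.
  by move=> e e' el ea /=; apply: (ea x y true true).
- exists r, I, L => G pi pi_inj colf c; exact: determined_not (IH G pi pi_inj colf c).
- eexists _, _, _ => G pi pi_inj colf c.
  exact: determined_and (IH1 G pi pi_inj colf c) (IH2 G pi pi_inj colf c).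
- eexists _, _, _ => G pi pi_inj colf c; exact: determined_ex (IH G pi pi_inj colf c).
Qed.

End QuantifierElimination.

Lemma wr_mono N (S : wsystem N) (r s : nat) (u v : point S) :
  r <= s -> wr r u v -> wr s u v.
Proof. by move=> /subnKC <-; apply: wr_addr. Qed.

(** On a path [u] occurs only as the end, so all earlier vertices lie at or above [v]. *)
Lemma reach_last (G : sgraph) (r : nat) (pi : G -> nat) (v u : G) :
  u \in reach r pi v ->
  u = v \/ exists q, [/\ path (@edge G) v q, edge (last v q) u, size q < r &
                         all (fun w => pi v <= pi w) (v :: q)].
Proof.
rewrite inE => /andP[_ /existsP[p /andP[/and3P[pp up /eqP lp] ap]]].
have sp := size_bseq p; case/lastP: (bseqval p) pp up lp ap sp => [|q w]; first by left.
rewrite rcons_path last_rcons size_rcons -rcons_cons rcons_uniq.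
move=> /andP[pq e] /andP[wq _] wu; rewrite wu in wq e * => aq sq.
right; exists q; split=> //; apply/allP => z zq.
move/allP: aq => /(_ z); rewrite mem_rcons inE zq orbT => /(_ isT)/orP[/eqP zu|//].
by rewrite -zu zq in wq.
Qed.

(** * Lacon-decompositions *)

Section Bipartite.
Variables (T X : finType) (inc : T -> X -> bool).

Definition bip_edge : rel (T + X) := fun u v =>
  match u, v with
  | inl t, inr x | inr x, inl t => inc t x
  | _, _ => false
  end.

Fact bip_sym : symmetric bip_edge. Proof. by case=> [t|x] [t'|x']. Qed.
Fact bip_irr : irreflexive bip_edge. Proof. by case. Qed.

Definition bip : sgraph := SGraph bip_sym bip_irr.

Definition targets : {set bip} := inl @: [set: T].

Lemma mem_targets (v : bip) : (v \in targets) = if v is inl _ then true else false.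
Proof.
by case: v => v; [apply/imset_f|apply/negbTE/imsetP => -[]].
Qed.

Lemma bip_bipartite : bipartite targets.
Proof. by move=> [t|x] [t'|x'] //= _; rewrite !mem_targets. Qed.

Lemma bip_nbrs t : nbrs (inl t : bip) = [set inr x | x in [set x | inc t x]].
Proof.
apply/setP => -[t'|x]; rewrite inE /=.
  by apply/esym/negbTE/imsetP => -[].
by rewrite (mem_imset _ _ (@inr_inj _ _)) inE.
Qed.

Definition bip_order (k : X -> nat) : bip -> nat :=
  refine (fun v : bip => if v is inr x then k x else (\max_x k x).+1).

Lemma bip_order_inr k x x' :
  bip_order k (inr x) <= bip_order k (inr x') -> k x <= k x'.
Proof. by move/refine_mono. Qed.

Lemma bip_order_inl k x t : bip_order k (inr x) < bip_order k (inl t).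
Proof.
rewrite ltnNge; apply/negP => /refine_mono /=.
by rewrite ltnNge leq_bigmax.
Qed.

(** Targets lie above all hidden vertices, so a target reaches only itself and its hidden neighbors.
    Along a walk above a hidden [x], every vertex weakly reaches [top x]: by transitivity on
    entering a target, by fraternity on entering a hidden vertex. A last use of fraternity turns
    this into reachability from [top x]. *)
Lemma bip_col N (S : wsystem N) (R C s : nat) (base : T -> point S)
    (top : X -> point S) (k : X -> nat) :
  (forall t x, inc t x -> wr R (base t) (top x)) ->
  (forall w, #|[set x | top x == w]| <= C) ->
  (forall x x', k x <= k x' -> key (top x) <= key (top x')) ->
  col s (bip_order k) <= (C * N R + C * N (R * s)).+1.
Proof.
move=> incwr fib kmono.
pose pt (v : bip) : point S := match v with inl t => base t | inr x => top x end.
have cardX r (w : point S) : #|[set (inr x : bip) | x in [set x | wr r w (top x)]]|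
  <= C * N r.
  apply: leq_trans (leq_imset_card _ _) _.
  have sub : [set x | wr r w (top x)] \subset \bigcup_(z in [set z | wr r w z])
    [set x | top x == z].
    by apply/subsetP => x; rewrite inE => wx; apply/bigcupP; exists (top x);
      rewrite inE.
  apply: leq_trans (subset_leq_card sub) _.
  by apply: leq_trans (card_bigcup_leq (fun z _ => fib z)) _;
    rewrite leq_mul2l wr_card orbT.
apply/bigmax_leqP => -[t|x] _.
  have sub : reach s (bip_order k) (inl t) \subset
      (inl t : bip) |: [set (inr x : bip) | x in [set x | wr R (base t) (top x)]].
    apply/subsetP => u /reach_last[->|[q [pq e _ aq]]]; first exact: setU11.
    rewrite in_setU1; apply/orP; right; case: q pq e aq => [|[t'|y] q] //=.
      by case: u => [//|y] _ ty _; apply/imsetP; exists y; rewrite // inE incwr.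
    by move=> _ _ /and3P[_]; rewrite leqNgt bip_order_inl.
  apply: leq_trans (subset_leq_card sub) _.
  apply: leq_trans (leq_card_setU _ _) _; rewrite cards1 add1n ltnS.
  by apply: leq_trans (cardX _ _) (leq_addr _ _).
apply: (@leq_trans (C * N (R * s))); last by rewrite ltnW // ltnS leq_addl.
rewrite (leq_trans _ (cardX _ (top x))) // subset_leq_card //.
apply/subsetP => u xu; have := xu; rewrite inE => /andP[le_u _].
case: u => [t|y] in xu le_u *; first by rewrite leqNgt bip_order_inl in le_u.
apply/imsetP; exists y => //; rewrite inE;
  case/reach_last: xu => [[->]|[q [pq e sq aq]]].
  exact: wr_refl.
have wr_last : wr (R * size q) (pt (last (inr x) q)) (top x).
  elim/last_ind: q pq aq {e sq} => [|q v IH]; first by move=> _ _; apply: wr_refl.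
  rewrite rcons_path last_rcons size_rcons -rcons_cons all_rcons.
  move=> /andP[pq e] /andP[xv aq]; have := IH pq aq.
  case: (last _ q) e => [t|z]; case: v xv => [t'|z'] //= xv tz wx; rewrite mulnS addnC.
    by apply: wr_frat wx (incwr _ _ tz) (kmono _ _ (bip_order_inr xv)).
  by rewrite addnC; apply: wr_trans (incwr _ _ tz) wx.
case: (last _ q) e wr_last => [t|z] //= ty tx.
apply: (@wr_mono _ _ (R + R * size q)); first by rewrite -mulnS leq_mul2l sq orbT.
exact: wr_frat (incwr _ _ ty) tx (kmono _ _ (bip_order_inr le_u)).
Qed.

End Bipartite.

Lemma set2_inj (T : finType) (x y z t : T) : [set x; y] = [set z; t] ->
  (x = z /\ y = t) \/ (x = t /\ y = z).
Proof.
move=> e; have := (set21 x y, set22 x y); have := (set21 z t, set22 z t).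
rewrite e -{1 2}e !inE => -[/orP zt /orP zt'] [/orP xy /orP xy'].
by case: zt zt' xy xy' => /eqP-> [] /eqP-> [] /eqP? [] /eqP?; auto.
Qed.

(** * Lacon-decompositions from coordinates and views *)

Section LaconOfTypes.
Variables (N : nat -> nat) (S : wsystem N) (H : sgraph) (I L : finType) (r : nat).
Variables (base : H -> point S) (a : I -> H -> point S) (lam : H -> L) (p0 : I).
Hypothesis a_wr : forall p u, wr r (base u) (a p u).
Hypothesis a_bot : forall u, a p0 u = bot S.
Hypothesis edge_det : forall u v u' v' : H, u != v -> u' != v' ->
  lam u = lam u' -> lam v = lam v' ->
  (forall p q, (a p u == a q u) = (a p u' == a q u')) ->
  (forall p q, (a p v == a q v) = (a p v' == a q v')) ->
  (forall p q, (a p u == a q v) = (a p u' == a q v')) ->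
  edge u v = edge u' v'.

Local Notation vw := (view r a lam).
Let V := view_type N I L r.
Let X : finType := (point S * {set V})%type.

Definition hidden_inc (u : H) (x : X) : bool :=
  [exists p, a p u == x.1] && (vw x.1 u \in x.2).

(* For equal points, smaller sets of views come later, so that the dominant
   vertex of [u] and [v] carries exactly the views of [u] and [v]. *)
Definition hidden_key (x : X) : nat := key x.1 * #|V|.+1 + #|~: x.2|.

Definition max_common (w : point S) (u v : H) : bool :=
  [&& [exists p, a p u == w], [exists p, a p v == w] &
      [forall p, forall q, (a p u == a q v) ==> (key (a p u) <= key w)]].

Definition hidden_label (x : X) : bool :=
  [exists u, exists v, [&& u != v, edge u v, max_common x.1 u v &
                           x.2 == [set vw x.1 u; vw x.1 v]]].

Lemma hidden_key_mono x x' : hidden_key x <= hidden_key x' -> key x.1 <= key x'.1.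
Proof.
apply: contraTT; rewrite -!ltnNge /hidden_key => lt.
apply: (@leq_trans ((key x'.1).+1 * #|V|.+1)).
  by rewrite mulSnr ltn_add2l ltnS max_card.
by rewrite (leq_trans _ (leq_addr _ _)) // leq_mul2r lt orbT.
Qed.

(** A common point of [u] and [v] lies at or below [w], so it is a down point of [w], and the views
    tell which one. *)
Lemma max_common_half w u v u' v' p q :
  max_common w u v -> vw w u = vw w u' -> vw w v = vw w v' ->
  a p u = a q v -> a p u' = a q v'.
Proof.
move=> /and3P[/existsP[p1 /eqP w1] _ /'forall_forallP/(_ p q)/implyP le] vu vv e.
have := le; rewrite e eqxx -e -w1 => /(_ isT) /(coord_down a_wr)[i iE].
rewrite w1 in iE; have /eqP-> : a p u' == down i w by rewrite -(view_down _ _ vu) iE.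
by apply/esym/eqP; rewrite -(view_down _ _ vv) iE e.
Qed.

(** This makes [hidden_label] independent of the witnessing pair. *)
Lemma max_common_edge w u v u' v' : u != v -> u' != v' ->
  max_common w u v -> max_common w u' v' ->
  vw w u = vw w u' -> vw w v = vw w v' -> edge u v = edge u' v'.
Proof.
move=> uv uv' m m' vu vv; apply: edge_det => //.
- exact: view_lam vu.
- exact: view_lam vv.
- by move=> p q; apply: view_eq vu.
- by move=> p q; apply: view_eq vv.
move=> p q; apply/eqP/eqP; first exact: max_common_half m vu vv.
exact: max_common_half m' (esym vu) (esym vv).
Qed.

Lemma max_commonC w u v : max_common w u v -> max_common w v u.
Proof.
case/and3P=> wu wv /'forall_forallP le; apply/and3P; split=> //.
apply/'forall_forallP => p q; apply/implyP => /eqP e.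
by have := le q p; rewrite e eqxx.
Qed.

Lemma lacon_of_types : lacon_decomposition
  (bip_order hidden_key : bip hidden_inc -> nat) H.
Proof.
exists (targets _), (fun v => if v is inr x then hidden_label x else false), inl.
split; first split.
- exact: bip_bipartite.
- exact: refine_inj.
- by move=> [t|x] [t'|x']; rewrite !mem_targets // bip_order_inl.
- move=> [t|x] [t'|x']; rewrite !mem_targets // => _ _.
  (* The bottom point with the set of all views is adjacent to every target. *)
  apply/set0Pn; exists (inr (bot S, setT)); rewrite !inE /= /hidden_inc !inE !andbT.
  by apply/andP; split; apply/existsP; exists p0; rewrite a_bot.
split; first by split; first exact: inl_inj.
move=> u v uv [t|[w P]] []; rewrite !inE //= /hidden_inc /=.
move=> /andP[/andP[wu Pu] /andP[wv Pv]] dom.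
have domk x : hidden_inc u x -> hidden_inc v x -> hidden_key x <= hidden_key (w, P).
  move=> ux vx; apply: bip_order_inr (dom (inr x) _).
  by apply/setIP; split; rewrite inE.
have m : max_common w u v.
  apply/and3P; split=> //; apply/'forall_forallP => p q; apply/implyP => /eqP e.
  apply: (hidden_key_mono (x := (a p u, setT)) (x' := (w, P))).
  by apply: domk; rewrite /hidden_inc inE andbT; apply/existsP; [exists p|exists q;
    rewrite e].
(* The vertex at [w] with exactly these two views is also a common neighbor; were [P] larger, that
   vertex would come later than the dominant one. *)
have PE : P = [set vw w u; vw w v].
  apply/esym/eqP; rewrite eqEcard subUset !sub1set Pu Pv.
  have := domk (w, [set vw w u; vw w v]).
  rewrite /hidden_inc /= wu wv set21 set22 => /(_ isT isT).
  rewrite /hidden_key /= leq_add2l => le.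
  by rewrite -(leq_add2r #|~: P|) cardsC -(cardsC [set vw w u; vw w v]) leq_add2l.
apply/idP/existsP => [e|[u' /existsP[v' /and4P[uv' e m' /eqP]]]].
  by exists u; apply/existsP; exists v; rewrite uv e m /= PE.
(* The label stores an unordered pair of views, so its witnesses may be swapped. *)
rewrite /= PE => /set2_inj[[vu vv]|[vu vv]].
  by rewrite (max_common_edge uv uv' m m').
by rewrite (max_common_edge uv _ m (max_commonC m')) // 1?eq_sym // edge_sym.
Qed.

Lemma lacon_of_types_col s :
  col s (bip_order hidden_key : bip hidden_inc -> nat) <=
    (#|{set V}| * N r + #|{set V}| * N (r * s)).+1.
Proof.
apply: (@bip_col _ _ _ N S r #|{set V}| s base fst hidden_key).
- by move=> u x /andP[/existsP[p /eqP<-] _].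
- move=> w; have sub : [set x : X | x.1 == w] \subset [set (w, P) | P : {set V}].
    by apply/subsetP => -[w' P]; rewrite inE => /eqP /= ->; apply: imset_f.
  exact: leq_trans (subset_leq_card sub) (leq_imset_card _ _).
- exact: hidden_key_mono.
Qed.

End LaconOfTypes.

Lemma sbe_lacon (C : graph_class) :
  structurally_bounded_expansion C ->
  exists f : nat -> nat, forall G : sgraph, C G ->
    exists (L : sgraph) (pi : L -> nat),
      lacon_decomposition pi G /\ forall r : nat, col r pi <= f r.
Proof.
case=> C' [[f C'f] [tau Ctau]].
have [r [I [L det]]] := sat_determined f (phi (basic tau)).
pose N s := (wcol_bound f s).+1; pose V := view_type N I L r.
exists (fun s => (#|{set V}| * N r + #|{set V}| * N (r * s)).+1) => H CH.
have [G C'G [c [H' H'E [g [h gh hg] gE]]]] := Ctau H CH.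
have [pi pi_inj colf] := C'f G C'G.
have {det} [a [lam [a_wr [p0 a_bot] aP]]] := det G pi pi_inj colf c.
move: H'E; rewrite /basic_apply; case: ifP => // _ [H'E]; subst H'.
pose S := graph_system pi_inj colf.
pose v (u : H) := val (h u).
have satE (u u' w w' : H) : lam (v u) = lam (v u') -> lam (v w) = lam (v w') ->
    (forall p q, (a p (v u) == a q (v u)) = (a p (v u') == a q (v u'))) ->
    (forall p q, (a p (v w) == a q (v w)) = (a p (v w') == a q (v w'))) ->
    (forall p q, (a p (v u) == a q (v w)) = (a p (v u') == a q (v w'))) ->
    sat (phi (basic tau)) [tuple v u; v w] = sat (phi (basic tau)) [tuple v u'; v w'].
  move=> lu lw uu ww uw; apply: aP => [i|i j p q].
    by case: (unliftP ord0 i) => [i'|] ->; rewrite ?(ord1 i').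
  case: (unliftP ord0 i) => [i'|] ->; case: (unliftP ord0 j) => [j'|] ->;
    rewrite ?(ord1 i') ?(ord1 j') /= ?uu ?ww ?uw //.
  by rewrite ![a p _ == _]eq_sym uw.
exists (bip (@hidden_inc N S H I L r (fun p u => a p (v u)) (lam \o v))).
exists (bip_order (@hidden_key N S I L r)); split; last first.
  by move=> s; apply: (@lacon_of_types_col N S H I L r (fun u =>
    Some (v u).1) (fun p u => a p (v u)) (lam \o v)) => p u; apply: a_wr.
apply: (@lacon_of_types N S H I L r (fun u => Some (v u).1) (fun p u =>
  a p (v u)) (lam \o v) p0) => //.
move=> u w u' w' uw uw' lu lw uu ww uw_.
rewrite -(hg u) -(hg w) -(hg u') -(hg w') !gE /= /basic_edge !(inj_eq (can_inj hg))
  uw uw' /=.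
congr (_ || _); apply: satE => // p q.
by rewrite ![a p _ == _]eq_sym.
Qed.

(** * Parity-decompositions *)

Section Parity.
Variables (G L : sgraph) (pi : L -> nat) (T : {set L}) (label : L -> bool) (g : G -> L).
Variable f : nat -> nat.
Hypotheses (bipL : bipartite T) (pi_inj : injective pi).
Hypothesis hid_lt : forall h t, h \notin T -> t \in T -> pi h < pi t.
Hypothesis common : forall t t', t \in T -> t' \in T -> nbrs t :&: nbrs t' != set0.
Hypothesis gT : identifies g T.
Hypothesis dom_edge : forall u v : G, u != v ->
  forall h, dominant pi (g u) (g v) h -> edge u v = label h.
Hypothesis colf : forall r, col r pi <= f r.

Lemma g_in u : g u \in T.
Proof. by case: gT => _ <-; apply: imset_f. Qed.

Lemma nbr_hidden u h : h \in nbrs (g u) -> h \notin T.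
Proof. by rewrite inE => /bipL; rewrite g_in; case: (h \in T). Qed.

Lemma nbr_lt u h : h \in nbrs (g u) -> pi h < pi (g u).
Proof. by move/nbr_hidden => hT; apply: hid_lt (g_in u). Qed.

Lemma nbrs_card u : #|nbrs (g u)| <= f 1.
Proof.
apply: leq_trans (colf 1); apply: leq_trans (reach_col 1 pi (g u)).
apply: subset_leq_card; apply/subsetP => h uh; apply/reachP; split.
  exact/ltnW/nbr_lt.
exists [:: h]; split=> //=; first by move: uh; rewrite inE => ->.
by rewrite eqxx leqnn orbT.
Qed.

(** The path through [g u] is admissible as targets lie above hidden vertices. A set of neighbors of
    one target is thus contained in what its largest element 2-reaches. *)
Lemma common_nbrs_reach u h h' : h \in nbrs (g u) -> h' \in nbrs (g u) ->
  pi h' <= pi h -> h' \in reach 2 pi h.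
Proof.
move=> uh uh' le; apply/reachP; split=> //; exists [:: g u; h']; split=> //=.
  by move: uh uh'; rewrite !inE edge_sym => -> ->.
by rewrite leqnn eqxx (ltnW (nbr_lt uh)) !orbT.
Qed.

Lemma dominant_ex u v : exists h, dominant pi (g u) (g v) h.
Proof.
have /set0Pn[h0 h0P] := common (g_in u) (g_in v).
case: (@arg_maxnP _ h0 (mem (nbrs (g u) :&: nbrs (g v))) pi h0P) => h hP hmax.
by exists h.
Qed.

Definition min_label (Z : {set L}) : bool :=
  [exists z in Z, label z && [forall z' in Z, pi z <= pi z']].

Lemma min_label_setU1 (m : L) (Z : {set L}) : Z != set0 ->
  (forall z, z \in Z -> pi z < pi m) -> min_label (m |: Z) = min_label Z.
Proof.
move=> /set0Pn[z0 z0Z] Zm; apply/existsP/existsP => -[z /and3P[zZ lz /forall_inP zmin]].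
  exists z; rewrite lz /=; case/setU1P: zZ => [zm|->].
    by have := zmin z0; rewrite zm setU1r // leqNgt Zm // => /(_ isT).
  by apply/forall_inP => z' z'Z; apply: zmin; rewrite setU1r.
exists z; rewrite setU1r // lz; apply/forall_inP => z' /setU1P[->|/zmin//].
exact/ltnW/Zm.
Qed.

(* Adding or removing the largest element [m] of [M] changes the minimum of no
   subset of [M] other than [set m] itself, so all other subsets cancel. *)
Lemma odd_min_label (M : {set L}) (m : L) :
  m \in M -> (forall z, z \in M -> pi z <= pi m) ->
  odd #|[set Z in powerset M | min_label Z]| = label m.
Proof.
move=> mM mmax; set A := [set Z in _ | _].
have lab0 : min_label set0 = false by apply/existsP => -[z]; rewrite inE.
have lab1 : min_label [set m] = label m.
  apply/existsP/idP => [[z /and3P[/set1P-> //]]|lm].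
  by exists m; rewrite set11 lm; apply/forall_inP => z /set1P->.
have ltm z : z \in M -> z != m -> pi z < pi m.
  by move=> zM; rewrite ltn_neqAle mmax // andbT; apply: contraNN => /eqP/pi_inj->.
pose B := [set Z in A | m \notin Z].
(* Subsets are paired by toggling [m]. The empty set is never counted, so its partner [[set m]] is
   left over and decides the parity. *)
have -> : A = B :|: [set m |: Z | Z in B] :|: (if label m then [set [set m]] else set0).
  apply/setP => Z; rewrite !inE.
  have [mZ|mZ] := boolP (m \in Z); last first.
    rewrite andbT orbC; case: imsetP => [[Z' _ ZE]|_]; first by rewrite ZE setU11 in mZ.
    case: (label m); rewrite !inE ?orbF //.
    by case: eqVneq => // ZE; rewrite ZE set11 in mZ.
  rewrite andbF /=; have [->|Zm] := eqVneq Z [set m].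
    rewrite sub1set mM lab1 /=; case: (label m); rewrite !inE ?eqxx ?orbT // orbF.
    apply/esym/imsetP => -[Z']; rewrite !inE => /andP[/andP[_ labZ'] mZ'] ZE.
    have Z'0 : Z' = set0.
      apply/setP => z; rewrite inE; apply/negbTE/negP => zZ'.
      have : z \in [set m] by rewrite ZE setU1r.
      by move/set1P => zm; rewrite -zm zZ' in mZ'.
    by rewrite Z'0 lab0 in labZ'.
  have -> : (Z \in (if label m then [set [set m]] else set0)) = false.
    by case: (label m); rewrite !inE // (negbTE Zm).
  rewrite orbF; have Zneq : Z :\ m != set0.
    apply: contraNneq Zm => Z0; rewrite -(setD1K mZ) Z0 setU0 //.
  apply/andP/imsetP => [[ZM labZ]|[Z' + ->]].
    exists (Z :\ m); last by rewrite setD1K.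
    rewrite !inE eqxx (subset_trans (subD1set _ _) ZM) /= andbT.
    rewrite -(@min_label_setU1 m) ?setD1K // => z /setD1P[zm /(subsetP ZM) zM].
    exact: ltm.
  rewrite !inE => /andP[/andP[Z'M labZ'] mZ']; split;
    first by rewrite subUset sub1set mM.
  rewrite min_label_setU1 //; first by apply: contraTneq labZ' => ->; rewrite lab0.
  move=> z zZ'; apply: ltm (subsetP Z'M _ zZ') _.
  by apply: contraNneq mZ' => <-.
have BU : [disjoint B & [set m |: Z | Z in B]].
  rewrite disjoint_subset; apply/subsetP => Z; rewrite !inE => /andP[_ mZ].
  by apply/imsetP => -[Z' _ ZE]; rewrite ZE setU11 in mZ.
have BC : #|[set m |: Z | Z in B]| = #|B|.
  apply: card_in_imset => Z Z'; rewrite !inE => /andP[_ mZ] /andP[_ mZ'] /setP e.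
  apply/setP => z; have := e z; rewrite !inE.
  by case: eqVneq => // ->; rewrite (negbTE mZ) (negbTE mZ').
have BUD : [disjoint B :|: [set m |: Z | Z in B] & (if label m then [set [set m]]
  else set0)].
  case: (label m); last by rewrite disjoint_sym disjoints_subset sub0set.
  rewrite disjoint_sym disjoints1 !inE eqxx andbF /=.
  apply/imsetP => -[Z']; rewrite !inE => /andP[/andP[_ labZ'] mZ'] ZE.
  have Z'0 : Z' = set0.
    apply/setP => z; rewrite inE; apply/negbTE/negP => zZ'.
    have : z \in [set m] by rewrite ZE setU1r.
    by move/set1P => zm; rewrite -zm zZ' in mZ'.
  by rewrite Z'0 lab0 in labZ'.
rewrite !cardsU !disjoint_setI0 // cards0 !subn0 BC addnn oddD odd_double.
by case: (label m); rewrite ?cards1 ?cards0.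
Qed.

(* The first component of a hidden vertex is the largest element of the second. *)
Definition parity_inc (u : G) (x : L * {set L}) : bool :=
  [&& x.1 \in x.2, x.2 \subset nbrs (g u), [forall z in x.2, pi z <= pi x.1]
    & min_label x.2].

(** Common hidden neighbors correspond to the counted subsets of the common neighborhood in the
    lacon, since the second component determines the first. The degree bound counts pairs of a
    neighbor and a set of neighbors. *)
Lemma parity_of_lacon :
  parity_decomposition (f 1 * 2 ^ f 1) (bip parity_inc) G.
Proof.
exists (targets _), inl; split.
- exact: bip_bipartite.
- move=> [u|x]; rewrite mem_targets // => _; rewrite bip_nbrs.
  apply: leq_trans (leq_imset_card _ _) _.
  apply: (@leq_trans #|setX (nbrs (g u)) (powerset (nbrs (g u)))|).
    apply/subset_leq_card/subsetP => -[z Z]; rewrite inE => /and4P[/= zZ ZN _ _].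
    by rewrite in_setX powersetE ZN andbT (subsetP ZN).
  by rewrite cardsX card_powerset leq_mul ?nbrs_card // leq_pexp2l ?nbrs_card.
- by split; first exact: inl_inj.
move=> u v uv; have [m [mM mmax]] := dominant_ex u v.
rewrite (dom_edge uv (conj mM mmax)) -(odd_min_label mM mmax) !bip_nbrs.
rewrite -imsetI; last by move=> ? ? _ _; apply: inr_inj.
rewrite card_imset; last exact: inr_inj.
congr odd; rewrite -(@card_in_imset _ _ snd).
  apply: eq_card => Z; rewrite !inE; apply/andP/imsetP => [[ZM lZ]|[[z Z'] + ->]].
    have Z0 : exists z, z \in Z by case/existsP: lZ => z /andP[zZ _]; exists z.
    have [z0 z0Z] := Z0.
    case: (@arg_maxnP _ z0 (mem Z) pi z0Z) => z zZ zmax.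
    exists (z, Z) => //; have {}zZ : z \in Z by []; move: ZM;
      rewrite subsetI !inE /parity_inc /= => /andP[-> ->].
    by rewrite zZ lZ !andbT; apply/andP; split; apply/forall_inP.
  by rewrite !inE => /andP[/and4P[_ ? _ ?] /and4P[_ ? _ _]]; rewrite subsetI;
    split=> //; apply/andP.
move=> [z Z] [z' Z']; rewrite !inE => /andP[/and4P[/= zZ _ /forall_inP zmax _] _].
move=> /andP[/and4P[/= z'Z _ /forall_inP z'max _] _] ZZ'; rewrite -ZZ' in z'Z z'max *.
by congr (_, _); apply: pi_inj; apply/eqP; rewrite eqn_leq zmax // z'max.
Qed.

Definition parity_map (v : bip parity_inc) : L :=
  match v with inl u => g u | inr x => x.1 end.

(** Forgetting the sets is a homomorphism to the lacon. A fibre has at most one target, and its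
    nonisolated hidden vertices carry subsets of a 2-reachability set. *)
Lemma parity_col r :
  col r (refine (fun v => pi (parity_map v))) <= ((2 ^ f 2).+1 * f r).+1.
Proof.
apply: (@leq_trans ((2 ^ f 2).+1 * col r pi).+1);
  last by rewrite ltnS leq_mul2l colf orbT.
apply: (col_weak_hom (h := parity_map)) => [||z].
- move=> [u|[z Z]] [u'|[z' Z']] //=;
  rewrite /parity_inc /= => /and4P[xx /subsetP xN _ _]; right.
    by have := xN _ xx; rewrite inE.
  by have := xN _ xx; rewrite inE edge_sym.
- by move=> x y /refine_mono.
have sub : [set x | (parity_map x == z) && (nbrs x != set0)] \subset
    [set inl u | u in [set u | g u == z]] :|:
    [set inr (z, Z) | Z in powerset (reach 2 pi z)].
  apply/subsetP => -[u|[z' Z]]; rewrite inE /= => /andP[/eqP zE].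
    by move=> _; apply/setUP; left; apply/imsetP; exists u; rewrite // inE zE.
  case/set0Pn => -[u|x]; rewrite inE //= /parity_inc =>
    /and4P[/= z'Z /subsetP ZN /forall_inP zmax _].
  apply/setUP; right; apply/imsetP; exists Z; last by rewrite -zE.
  rewrite inE; apply/subsetP => h hZ; rewrite -zE.
  exact: (common_nbrs_reach (ZN _ z'Z) (ZN _ hZ) (zmax _ hZ)).
apply: leq_trans (subset_leq_card sub) _.
apply: leq_trans (leq_card_setU _ _) _; rewrite -[(2 ^ f 2).+1]add1n leq_add //.
  apply: leq_trans (leq_imset_card _ _) _.
  case: gT => g_inj _; rewrite -(card_imset _ g_inj) -(cards1 z) subset_leq_card //.
  by apply/subsetP => z' /imsetP[u]; rewrite !inE => /eqP-> ->.
apply: leq_trans (leq_imset_card _ _) _; rewrite card_powerset leq_pexp2l //.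
by apply: leq_trans (reach_col _ _ _) (colf 2).
Qed.

End Parity.

Lemma lacon_parity (C : graph_class) :
  (exists f : nat -> nat, forall G : sgraph, C G ->
     exists (L : sgraph) (pi : L -> nat),
       lacon_decomposition pi G /\ forall r : nat, col r pi <= f r) ->
  exists (d : nat) (C' : graph_class), bounded_expansion C' /\
    forall G : sgraph, C G -> exists P : sgraph, C' P /\ parity_decomposition d P G.
Proof.
case=> f Cf; pose F r := ((2 ^ f 2).+1 * f r).+1.
exists (f 1 * 2 ^ f 1), (fun P : sgraph =>
  exists2 pi : P -> nat, injective pi & forall r, col r pi <= F r).
split; first by exists F.
move=> G /Cf[L [pi [[T [label [g [[bipL pi_inj hid_lt common] [gT dom_edge]]]]] colf]]].
exists (bip (parity_inc pi label g)); split.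
  exists (refine (fun v => pi (parity_map v))); first exact: refine_inj.
  exact: parity_col bipL hid_lt gT colf.
exact: parity_of_lacon bipL pi_inj hid_lt common gT dom_edge colf.
Qed.

(** * First-order definability of distances and parities *)

Section Formulas.
Variables (U : Type).
Local Notation fo := (fo U (option unit)).

Definition fo_edge n (x y : 'I_n) : fo n := FBin U (Some tt) x y.

Fixpoint fo_dist_le (l n : nat) (x y : 'I_n) : fo n :=
  if l is l'.+1 then
    FNot (FAnd (FNot (fo_dist_le l' x y))
      (FNot (FEx (FAnd (fo_edge (lift ord0 x) ord0)
                       (fo_dist_le l' ord0 (lift ord0 y))))))
  else FEq _ _ x y.

(* For distances at most [l]: the distance satisfies [P]. *)
Fixpoint fo_dist_in (P : pred nat) (l n : nat) (x y : 'I_n) : fo n :=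
  if l is l'.+1 then
    if P l then FNot (FAnd (fo_dist_le l' x y) (FNot (fo_dist_in P l' x y)))
    else FAnd (fo_dist_le l' x y) (fo_dist_in P l' x y)
  else FNot (FEq _ _ x x).

Definition fo_notin n (x : 'I_n) (s : seq 'I_n) : fo n :=
  foldr (fun y phi => FAnd (FNot (FEq _ _ x y)) phi) (FEq _ _ x x) s.

(* If [x] and [y] have at most [k] common neighbors outside [s], then their
   number is odd. *)
Fixpoint fo_odd_common (k n : nat) (s : seq 'I_n) (x y : 'I_n) : fo n :=
  if k is k'.+1 then
    FEx (FAnd (FAnd (fo_edge (lift ord0 x) ord0) (fo_edge (lift ord0 y) ord0))
        (FAnd (fo_notin ord0 (map (lift ord0) s))
              (FNot (fo_odd_common k' (ord0 :: map (lift ord0) s)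
                       (lift ord0 x) (lift ord0 y)))))
  else FNot (FEq _ _ x x).

End Formulas.

Section Satisfaction.
Variables (p : nat) (F : sgraph) (c : 'I_p -> pred F).
Let A : structure ('I_p + 'I_1) (option unit) := copy 1 (expand c).
Local Notation sat := (@sat _ _ A _).

Lemma sat_not n (phi : fo _ _ n) e : sat (FNot phi) e = ~~ sat phi e.
Proof. by []. Qed.

Lemma sat_and n (phi psi : fo _ _ n) e : sat (FAnd phi psi) e = sat phi e && sat psi e.
Proof. by []. Qed.

Lemma sat_ex n (phi : fo _ _ n.+1) e :
  sat (FEx phi) e = [exists z : A, sat phi [tuple of z :: e]].
Proof. by []. Qed.

Lemma copy1_eq (x y : A) : (x == y) = (x.1 == y.1).
Proof. by case: x y => [x i] [y j]; rewrite -pair_eqE /= !ord1 eqxx andbT. Qed.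

Lemma sat_edge n (x y : 'I_n) e : sat (fo_edge _ x y) e = edge (tnth e x).1 (tnth e
  y).1.
Proof. by rewrite /= !ord1 eqxx andbT. Qed.

Lemma sat_dist_le l n (x y : 'I_n) e :
  reflect (exists q, [/\ path (@edge F) (tnth e x).1 q,
                         last (tnth e x).1 q = (tnth e y).1 & size q <= l])
          (sat (fo_dist_le _ l x y) e).
Proof.
elim: l n x y e => [|l IH] n x y e.
  rewrite /= copy1_eq; apply: (iffP eqP) => [xy|[q [_ lq]]]; first by exists [::].
  by rewrite leqn0 => /nilP q0; rewrite -lq q0.
rewrite [fo_dist_le _ _ _ _]/= !(sat_not, sat_and) negb_and !negbK sat_ex.
apply: (iffP orP) => [[/IH[q [pq lq sq]]|/existsP[z]]|[q]].
- by exists q; split=> //; apply: leqW.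
- rewrite sat_and sat_edge tnthS tnth0 => /andP[xz /IH[q []]].
  by rewrite tnthS tnth0 => pq lq sq; exists (z.1 :: q); rewrite /= xz.
case: q => [|z q] [/= pq lq sq]; first by left; apply/IH; exists [::].
case/andP: pq => xz pq; right; apply/existsP; exists (z, ord0).
apply/andP; split; first by rewrite !ord1 eqxx andbT tnthS tnth0.
by apply/IH; exists q; rewrite tnthS tnth0.
Qed.

Lemma sat_dist_in (P : pred nat) l n (x y : 'I_n) e k : 0 < k <= l ->
  (exists q, [/\ path (@edge F) (tnth e x).1 q,
                 last (tnth e x).1 q = (tnth e y).1 & size q <= k]) ->
  (forall q, path (@edge F) (tnth e x).1 q ->
             last (tnth e x).1 q = (tnth e y).1 -> k <= size q) ->
  sat (fo_dist_in _ P l x y) e = P k.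
Proof.
elim: l => [|l IH]; first by case: k.
case/andP=> k0; rewrite leq_eqVlt ltnS => kl [q [pq lq sq]] kmin.
have satE : sat (fo_dist_le _ l x y) e = (k <= l).
  apply/sat_dist_le/idP => [[q' [pq' lq' sq']]|le];
    first exact: leq_trans (kmin q' _ _) _.
  by exists q; split=> //; apply: leq_trans sq le.
rewrite [fo_dist_in _ _ _ _ _]/=; case Pl: (P l.+1); rewrite !(sat_not, sat_and) satE.
  case: (leqP k l) kl => [le _|lt /orP[/eqP->|]]; rewrite ?Pl ?(leqNgt k l) ?lt //=.
  by rewrite negbK IH ?k0 //; exists q.
case: (leqP k l) kl => [le _|lt /orP[/eqP->|]]; rewrite ?Pl ?(leqNgt k l) ?lt //=.
by rewrite IH ?k0 //; exists q.
Qed.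

Lemma sat_notin n (x : 'I_n) s e :
  sat (fo_notin _ x s) e = ((tnth e x).1 \notin [seq (tnth e y).1 | y <- s]).
Proof.
elim: s => [|y s IH] /=; first by rewrite eqxx.
by rewrite inE negb_or -IH copy1_eq.
Qed.

(** A set has odd size exactly when it has an element whose removal leaves an even size; [s] lists
    the removed elements. *)
Lemma sat_odd_common k n s (x y : 'I_n) e (D : {set F}) :
  D = [set z in nbrs (tnth e x).1 :&: nbrs (tnth e y).1 |
         z \notin [seq (tnth e i).1 | i <- s]] ->
  #|D| <= k -> sat (fo_odd_common _ k s x y) e = odd #|D|.
Proof.
elim: k n s x y e D => [|k IH] n s x y e D DE.
  by rewrite leqn0 => /eqP->; rewrite /= eqxx.
move=> Dk.
have stepE (z : A) : sat (FAnd (FAnd (fo_edge _ (lift ord0 x) ord0) (fo_edge _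
  (lift ord0 y) ord0))
        (FAnd (fo_notin _ ord0 (map (lift ord0) s))
              (FNot (fo_odd_common _ k (ord0 :: map (lift ord0) s)
                       (lift ord0 x) (lift ord0 y))))) [tuple of z :: e] =
    (z.1 \in D) && odd #|D|.
  have mapE : [seq (tnth [tuple of z :: e] i).1 | i <- [seq lift ord0 i | i <- s]]
    = [seq (tnth e i).1 | i <- s].
    by rewrite -map_comp; apply: eq_map => i /=; rewrite tnthS.
  transitivity ((z.1 \in D) && ~~ sat (fo_odd_common _ k (ord0 :: map (lift ord0) s)
                       (lift ord0 x) (lift ord0 y)) [tuple of z :: e]).
    by rewrite DE !(sat_not, sat_and) !sat_edge sat_notin mapE !tnthS tnth0 !inE !andbA.
  have [zD|//] := boolP (z.1 \in D); rewrite /= (IH _ _ _ _ _ (D :\ z.1)).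
  - by rewrite (cardsD1 z.1 D) zD.
  - apply/setP => w; rewrite map_cons mapE !tnthS tnth0 DE !inE.
    by rewrite negb_or; case: (w == z.1); rewrite ?andbF.
  - by move: Dk; rewrite (cardsD1 z.1 D) zD.
rewrite [fo_odd_common _ _ _ _ _]/= sat_ex.
apply/existsP/idP => [[z]|Dodd]; first by rewrite stepE => /andP[].
have /set0Pn[z zD] : D != set0 by apply: contraTneq Dodd => ->; rewrite cards0.
by exists (z, ord0); rewrite stepE zD.
Qed.

End Satisfaction.

(** The single color marks the image of [g], which [nu] selects; [chi] is a valid sentence, and one
    copy is made. *)
Lemma fo_sbe (C C' : graph_class) (phi : fo ('I_1 + 'I_1) (option unit) 2) :
  bounded_expansion C' ->
  (forall G : sgraph, C G -> exists F : sgraph, C' F /\ exists g : G -> F,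
     injective g /\ forall (c : 'I_1 -> pred F) (u v : G), u != v ->
       edge u v = @sat _ _ (copy 1 (expand c)) 2 phi
                    [tuple (g u, ord0); (g v, ord0)]) ->
  structurally_bounded_expansion C.
Proof.
move=> C'be CC'; exists C'; split=> //.
pose t := BasicTransduction (FNot (FEx (FNot (FEq _ _ ord0 ord0)))) (FUn _ (inl
  ord0) ord0) phi.
exists (@Transduction 1 1 (ltn0Sn 0) t) => G /CC'[F [C'F [g [g_inj gE]]]].
exists F => //; pose c : 'I_1 -> pred F := fun _ x => x \in codom g.
exists c; rewrite /basic_apply /=; case: ifP => [_|/negbT/negP[]]; last first.
  by apply/existsP => -[x]; rewrite eqxx.
eexists; first by [].
have mem (x : basic_vertex t (copy 1 (expand c))) : (val x).1 \in codom g by case: x.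
have mem' (u : G) : @sat _ _ (copy 1 (expand c)) 1 (nu t) [tuple (g u, ord0)] by
  apply: codom_f.
pose h (x : basic_vertex t (copy 1 (expand c))) : G := iinv (mem x).
have gh x : g (h x) = (val x).1 by apply: f_iinv.
have valE x : val x = (g (h x), ord0) by rewrite gh; case: (val x) => y i;
  rewrite (ord1 i).
exists h => [|x y].
  exists (fun u => exist _ (g u, ord0) (mem' u)) => [x|u]; last by apply: g_inj;
    rewrite gh.
  by apply: val_inj; rewrite /= -valE.
rewrite [RHS]/= /basic_edge; have [->|xy] := eqVneq x y; first by rewrite edge_irr.
have hxy : h x != h y by apply: contraNneq xy => e; apply/eqP/val_inj; rewrite !valE e.
rewrite !valE -!(gE c) // 1?eq_sym //.
by rewrite [edge (h y) _]edge_sym orbb.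
Qed.

Lemma walk_is_path (G : sgraph) (u : G) (q : seq G) : path (@edge G) u q ->
  exists2 p, is_path u (last u q) p & size p <= size q.
Proof.
case/shortenP => p pp up sub_p; exists p; first by rewrite /is_path pp up eqxx.
by case/andP: up => _ up; apply: uniq_leq_size up sub_p.
Qed.

Lemma has_dist_ex (G : sgraph) (u v : G) (d : nat) : dist_at_most u v d ->
  exists2 k, k <= d & has_dist u v k.
Proof.
case=> p0 p0P sp0.
have [|k /existsP[p pP] kmin] := @ex_minnP (fun k =>
  [exists p : k.-tuple G, is_path u v p]).
  by exists (size p0); apply/existsP; exists (in_tuple p0).
have kP q : is_path u v q -> k <= size q.
  by move=> qP; apply: kmin; apply/existsP; exists (in_tuple q).
exists k; first exact: leq_trans (kP _ p0P) sp0.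
by split=> //; exists p; rewrite ?size_tuple.
Qed.

Lemma shrub_sbe (C : graph_class) :
  (exists (d : nat) (S : {set 'I_1 * 'I_1 * 'I_d.+1}) (C' : graph_class),
     bounded_expansion C' /\
     forall G : sgraph, C G ->
       exists F : sgraph, C' F /\ shrub_decomposition F S G) ->
  structurally_bounded_expansion C.
Proof.
case=> d [S [C' [C'be CC']]].
(* With one color, the signature is a predicate on distances. *)
pose P l := (ord0, ord0, inord l) \in S.
apply: (@fo_sbe C C' (fo_dist_in _ P d ord0 (lift ord0 ord0)) C'be) => G /CC'[F [C'F]].
case=> S_gt0 _ diam [g [color [[g_inj _] gE]]]; exists F; split=> //; exists g;
  split=> // c u v uv.
have [k kd kP] := has_dist_ex (diam (g u) (g v)).
have kE : nat_of_ord (inord k : 'I_d.+1) = k by rewrite inordK.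
have [[p pP sp] kmin] := kP; have [pp _ /eqP lp] := and3P pP.
rewrite (@sat_dist_in _ _ _ _ _ _ _ _ _ k).
- rewrite (gE u v (inord k)) ?kE // /P.
  by rewrite (ord1 (color u)) (ord1 (color v)).
- rewrite kd andbT -sp; case: (p) lp => //= guv.
  by move/g_inj: guv uv => ->; rewrite eqxx.
- by exists p; rewrite sp.
move=> q pq lq; have [q' q'P sq'] := walk_is_path pq; rewrite lq in q'P.
exact: leq_trans (kmin q' q'P) sq'.
Qed.

Lemma parity_sbe (C : graph_class) :
  (exists (d : nat) (C' : graph_class), bounded_expansion C' /\
     forall G : sgraph, C G ->
       exists P : sgraph, C' P /\ parity_decomposition d P G) ->
  structurally_bounded_expansion C.
Proof.
case=> d [C' [C'be CC']].
apply: (@fo_sbe C C' (fo_odd_common _ d [::] ord0 (lift ord0 ord0)) C'be).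
move=> G /CC'[P [C'P [T [g [_ deg [g_inj gT] gE]]]]].
exists P; split=> //; exists g; split=> // c u v uv.
rewrite gE // (@sat_odd_common _ _ _ _ _ _ _ _ _ (nbrs (g u) :&: nbrs (g v))) //.
  by apply/setP => z; rewrite !inE andbT.
apply: leq_trans (deg (g u) _); first by apply: subset_leq_card; apply: subsetIl.
by rewrite -gT imset_f.
Qed.

(** * Shrub-decompositions *)

Definition walk (G : sgraph) (n : nat) (x y : G) : Prop :=
  exists p, [/\ path (@edge G) x p, last x p = y & size p = n].

Section Walk.
Variable G : sgraph.
Implicit Types x y z : G.

Lemma walk0 x : walk 0 x x. Proof. by exists [::]. Qed.

Lemma walk1 x y : edge x y -> walk 1 x y.
Proof. by move=> e; exists [:: y]; rewrite /= e. Qed.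

Lemma walk_trans m n x y z : walk m x y -> walk n y z -> walk (m + n) x z.
Proof.
move=> [p [pp lp sp]] [q [pq lq sq]]; exists (p ++ q).
by rewrite cat_path last_cat size_cat pp lp pq lq sp sq.
Qed.

Lemma walk_sym n x y : walk n x y -> walk n y x.
Proof.
case=> p [pp <- <-]; elim: p x pp => [|z p IH] x /=; first by exists [::].
case/andP=> e /IH pz; rewrite -addn1; apply: walk_trans pz _.
by apply: walk1; rewrite edge_sym.
Qed.

Lemma walk_dist n m x y : walk n x y -> n <= m -> dist_at_most x y m.
Proof.
move=> [p [pp <- <-]] sm; have [q qP sq] := walk_is_path pp.
by exists q => //; apply: leq_trans sq sm.
Qed.

Lemma has_dist_eq n l x y : walk n x y ->
  (forall p, path (@edge G) x p -> last x p = y -> n <= size p) ->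
  has_dist x y l -> l = n.
Proof.
move=> [p [pp lpy sp]] nmin [[q qP sq] lmin].
have [p' p'P sp'] := walk_is_path pp; rewrite lpy in p'P.
apply/eqP; rewrite eqn_leq -{1}sp (leq_trans (lmin _ p'P)) //=.
by have [pq _ /eqP lq] := and3P qP; rewrite -sq nmin.
Qed.

(** Potentials that grow by at most one per edge give lower bounds on distances. *)
Lemma potential_path (g : G -> nat) x p :
  (forall x y, edge x y -> g y <= (g x).+1) ->
  path (@edge G) x p -> g (last x p) <= g x + size p.
Proof.
move=> lip; elim: p x => [|y p IH] x /=; first by rewrite addn0.
case/andP=> /lip xy /IH; rewrite addnS -addSn => le.
by apply: leq_trans le _; rewrite leq_add2r.
Qed.

End Walk.

(** * Subdivisions of multigraphs *)

Section Subdivision.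
Variables (B Ed : finType) (src dst : Ed -> B) (len : Ed -> nat).
Hypothesis len_gt0 : forall e, 0 < len e.

Definition sub_vertex : finType := (B + {e : Ed & 'I_(len e)})%type.

Definition interior (e : Ed) (j : 'I_(len e)) : sub_vertex := inr (Tagged _ j).

Definition sub_half (x y : sub_vertex) : bool :=
  match x, y with
  | inl b, inr (existT e j) =>
      ((src e == b) && (j == 0 :> nat)) || ((dst e == b) && (j.+1 == len e))
  | inr (existT e j), inr (existT e' j') => (e == e') && (j.+1 == j' :> nat)
  | _, _ => false
  end.

Definition sub_edge : rel sub_vertex := fun x y => sub_half x y || sub_half y x.

Fact sub_edge_sym : symmetric sub_edge.
Proof. by move=> x y; rewrite /sub_edge orbC. Qed.

Fact sub_edge_irr : irreflexive sub_edge.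
Proof.
by case=> [b|[e j]] //=; rewrite /sub_edge /= eqxx orbb /=; apply/negbTE;
  rewrite neq_ltn ltnSn orbT.
Qed.

Definition subdivision : sgraph := SGraph sub_edge_sym sub_edge_irr.

(** The edge [e] becomes a path of length [(len e).+1]; inside it, this is the largest extension of
    [g0] that changes by at most one per step. *)
Definition sub_pot (g0 : B -> nat) (x : subdivision) : nat :=
  match x with
  | inl b => g0 b
  | inr (existT e j) => minn (g0 (src e) + j.+1) (g0 (dst e) + (len e - j))
  end.

Lemma sub_pot_edge (g0 : B -> nat) :
  (forall e, g0 (src e) <= g0 (dst e) + (len e).+1) ->
  (forall e, g0 (dst e) <= g0 (src e) + (len e).+1) ->
  forall x y, edge x y -> sub_pot g0 y <= (sub_pot g0 x).+1.
Proof.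
move=> sd ds; suff half x y : sub_half x y ->
    sub_pot g0 y <= (sub_pot g0 x).+1 /\ sub_pot g0 x <= (sub_pot g0 y).+1.
  by move=> x y; rewrite [edge _ _]/= /sub_edge => /orP[/half[]|/half[]].
case: x y => [b|[e j]] [b'|[e' j']] //=.
  have lt_j := ltn_ord j'; have sde := sd e'; have dse := ds e'.
  by case/orP=> /andP[/eqP<- /eqP]; lia.
by case/andP=> /eqP ee; subst e'; have := ltn_ord j'; lia.
Qed.

Lemma walk_src e (j : 'I_(len e)) : @walk subdivision j.+1 (inl (src e)) (interior j).
Proof.
case: j => j; elim: j => [|j IH] lt_j.
  by apply: walk1; rewrite /= /sub_edge /= !eqxx.
rewrite -addn1; apply: walk_trans (IH (ltnW lt_j)) _; apply: walk1.
by rewrite /= /sub_edge /= !eqxx.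
Qed.

Lemma walk_sub e : @walk subdivision (len e).+1 (inl (src e)) (inl (dst e)).
Proof.
have lt : (len e).-1 < len e by rewrite prednK.
rewrite -addn1 -(prednK (len_gt0 e)).
apply: walk_trans (walk_src (Ordinal lt)) _; apply: walk1.
by rewrite /= /sub_edge /= prednK // !eqxx orbT.
Qed.

Definition first_interior e : subdivision := interior (Ordinal (len_gt0 e)).

Fact last_proof e : (len e).-1 < len e. Proof. by rewrite prednK. Qed.
Definition last_interior e : subdivision := interior (Ordinal (last_proof e)).

Lemma edge_first e : edge (inl (src e) : subdivision) (first_interior e).
Proof. by rewrite /= /sub_edge /= !eqxx. Qed.

Lemma edge_last e : edge (inl (dst e) : subdivision) (last_interior e).
Proof. by rewrite /= /sub_edge /= prednK // !eqxx orbT. Qed.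

(** The neighbors toward the two ends could coincide only in a common end of [e]. *)
Lemma interior_nbrs e (j : 'I_(len e)) : src e != dst e ->
  1 < #|nbrs (interior j : subdivision)|.
Proof.
move=> sd; apply/card_gt1P.
have [x [jx xP]] : exists x : subdivision, edge (interior j : subdivision) x /\
    match x with inl b => b = src e | inr (existT _ i) => i < j end.
  case: j => -[|j] lt_j.
    by exists (inl (src e)); rewrite /= /sub_edge /= !eqxx.
  by exists (interior (Ordinal (ltnW lt_j))); rewrite /= /sub_edge /= !eqxx orbT.
have [y [jy yP]] : exists y : subdivision, edge (interior j : subdivision) y /\
    match y with inl b => b = dst e | inr (existT _ i) => j < i end.
  have [lt_j|ge_j] := ltnP j.+1 (len e).
    by exists (interior (Ordinal lt_j)); rewrite /= /sub_edge /= !eqxx.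
  exists (inl (dst e)); split=> //; rewrite /= /sub_edge /= eqxx /=.
  by apply/orP; right; rewrite eqn_leq ge_j ltn_ord.
exists x, y; split; rewrite ?inE //; apply: contraNneq sd => xy;
  rewrite -{y}xy in yP jy.
by case: x xP yP {jx jy} => [b -> ->|[e' i] ij ji] //; lia.
Qed.

End Subdivision.

(** * The shrub of a lacon-decomposition *)

Section Shrub.
Variables (G L : sgraph) (pi : L -> nat) (T : {set L}) (label : L -> bool) (g : G -> L).
Variable f : nat -> nat.
Hypotheses (bipL : bipartite T) (pi_inj : injective pi).
Hypothesis hid_lt : forall h t, h \notin T -> t \in T -> pi h < pi t.
Hypothesis common : forall t t', t \in T -> t' \in T -> nbrs t :&: nbrs t' != set0.
Hypothesis gT : identifies g T.
Hypothesis dom_edge : forall u v : G, u != v ->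
  forall h, dominant pi (g u) (g v) h -> edge u v = label h.
Hypothesis colf : forall r, col r pi <= f r.

Let k := f 1.

Definition rank (u : G) (h : L) : nat := #|[set h' in nbrs (g u) | pi h' < pi h]|.

(* The coefficient 4 makes the position of [h] outweigh its label, and leaves the
   parity of half the sum of two lengths to the label. *)
Definition link_length (u : G) (h : L) : nat :=
  8 * k + 2 + 4 * (k - rank u h) + label h.

Definition hub : finType := {h : L | [exists u, h \in nbrs (g u)]}.
Definition link : finType := {x : G * hub * bool | val x.1.2 \in nbrs (g x.1.1)}.

Definition shrub_base : finType := (G + G + hub)%type.
Definition pend (u : G) : shrub_base := inl (inl u).
Definition ctr (u : G) : shrub_base := inl (inr u).

Definition shrub_src (e : G + link) : shrub_base :=
  match e with inl u => pend u | inr x => ctr (val x).1.1 end.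
Definition shrub_dst (e : G + link) : shrub_base :=
  match e with inl u => ctr u | inr x => inr (val x).1.2 end.
Definition shrub_len (e : G + link) : nat :=
  match e with
  | inl u => 1
  | inr x => (link_length (val x).1.1 (val (val x).1.2)).-1
  end.

Fact shrub_len_gt0 e : 0 < shrub_len e.
Proof. by case: e => //= x; rewrite /link_length; lia. Qed.

(* Every vertex [u] of [G] is a pendant vertex attached to a center, which is
   joined by two parallel links to each of its neighbors in the lacon; two links
   keep the hubs from having degree one. *)
Definition shrub : sgraph := subdivision shrub_src shrub_dst shrub_len.

Local Notation nbr_card := (nbrs_card bipL hid_lt gT colf).

Lemma rank_lt u h : h \in nbrs (g u) -> rank u h < k.
Proof.
move=> uh; apply: leq_trans (nbr_card u); apply: proper_card; apply/properP; split.
  by apply/subsetP => h'; rewrite inE => /andP[].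
by exists h; rewrite // inE ltnn andbF.
Qed.

Lemma rank_mono u h m : h \in nbrs (g u) -> pi h < pi m -> rank u h < rank u m.
Proof.
move=> uh hm; apply: proper_card; apply/properP; split.
  by apply/subsetP => h'; rewrite !inE => /andP[-> /ltn_trans->].
by exists h; rewrite inE uh ?hm ?ltnn.
Qed.

Lemma link_length_ge u h : 8 * k + 2 <= link_length u h.
Proof. by rewrite /link_length; lia. Qed.

Lemma link_length_le u h : link_length u h <= 12 * k + 3.
Proof. by rewrite /link_length; case: (label h); lia. Qed.

Lemma link_length_mono u h m : h \in nbrs (g u) -> m \in nbrs (g u) ->
  pi h <= pi m -> link_length u m <= link_length u h.
Proof.
move=> uh um; rewrite leq_eqVlt => /orP[/eqP/pi_inj->//|hm].
have := rank_mono uh hm; have := rank_lt uh; have := rank_lt um.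
by rewrite /link_length; case: (label h); case: (label m); lia.
Qed.

Lemma link_length_odd u v h : h \in nbrs (g u) -> h \in nbrs (g v) ->
  odd (4 + link_length u h + link_length v h)./2 = label h.
Proof.
move=> uh vh; have ru := rank_lt uh; have rv := rank_lt vh.
rewrite /link_length; set a := k - rank u h; set b := k - rank v h.
have -> : 4 + (8 * k + 2 + 4 * a + label h) + (8 * k + 2 + 4 * b + label h) =
    (label h + (4 * k + 2 + a + b).*2).*2 by lia.
by rewrite doubleK oddD odd_double addbF oddb.
Qed.

Lemma hub_proof u h : h \in nbrs (g u) -> [exists u, h \in nbrs (g u)].
Proof. by move=> uh; apply/existsP; exists u. Qed.

Definition hub_of u h (uh : h \in nbrs (g u)) : hub := Sub h (hub_proof uh).

Definition link_of u h (uh : h \in nbrs (g u)) (b : bool) : link :=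
  @Sub _ _ link (u, hub_of uh, b) uh.

Lemma walk_link u (h : hub) : val h \in nbrs (g u) ->
  @walk shrub (link_length u (val h)) (inl (ctr u)) (inl (inr h)).
Proof.
move=> uh; have := walk_sub shrub_src shrub_dst shrub_len_gt0 (inr (link_of uh true)).
rewrite /= prednK; last by rewrite (leq_trans _ (link_length_ge _ _)) // addn2.
by rewrite (_ : hub_of uh = h) //; apply: val_inj.
Qed.

Lemma walk_pend u : @walk shrub 2 (inl (pend u)) (inl (ctr u)).
Proof. exact: (walk_sub shrub_src shrub_dst shrub_len_gt0 (inl u)). Qed.

Lemma walk_ctr u v h : h \in nbrs (g u) -> h \in nbrs (g v) ->
  @walk shrub (link_length u h + link_length v h) (inl (ctr u)) (inl (ctr v)).
Proof.
move=> uh vh; apply: walk_trans (walk_link (h := hub_of uh) uh) _.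
exact/walk_sym/(walk_link (h := hub_of uh) vh).
Qed.

Lemma walk_to_ctr (x : shrub) : exists u n, n <= 12 * k + 3 /\ walk n x (inl (ctr u)).
Proof.
case: x => [[[u|u]|h]|[[u|x] j]].
- by exists u, 2; split; [lia|apply: walk_pend].
- by exists u, 0; split=> //; apply: walk0.
- have /existsP[u uh] := valP h; exists u, (link_length u (val h)).
  by split; [apply: link_length_le|apply/walk_sym/walk_link].
- exists u, 1; split; first lia; apply/walk_sym/walk1.
  have := edge_last shrub_src shrub_dst shrub_len_gt0 (inl u).
  by rewrite /last_interior (_ : Ordinal _ = j) //; apply: val_inj; rewrite /= (ord1 j).
exists (val x).1.1, j.+1; split; last by apply/walk_sym; apply: (walk_src shrub_src).
exact: leq_trans (ltn_ord j) (leq_trans (leq_pred _) (link_length_le _ _)).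
Qed.

(** Every vertex is within one maximal link length of a center, and two centers are joined by two
    links through a common hub. *)
Lemma shrub_diam (x y : shrub) : dist_at_most x y (4 * (12 * k + 3)).
Proof.
have [u [m [mk xu]]] := walk_to_ctr x; have [v [n [nk yv]]] := walk_to_ctr y.
have [h [hM _]] := dominant_ex pi common gT u v; have [uh vh] := setIP hM.
apply: walk_dist (walk_trans xu (walk_trans (walk_ctr uh vh) (walk_sym yv))) _.
have := link_length_le u h; have := link_length_le v h; lia.
Qed.

Definition dom u v : L :=
  odflt (g u) [pick h in nbrs (g u) :&: nbrs (g v) |
                [forall h' in nbrs (g u) :&: nbrs (g v), pi h' <= pi h]].

Lemma domP u v : dominant pi (g u) (g v) (dom u v).
Proof.
rewrite /dom; case: pickP => [h /andP[hM /forall_inP hmax]|none] //.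
have [h [hM hmax]] := dominant_ex pi common gT u v.
by have := none h; rewrite hM; case/forall_inP.
Qed.

Definition shrub_dist u v : nat :=
  4 + link_length u (dom u v) + link_length v (dom u v).

(* The distances from [pend u], except that hubs not adjacent to [u] get a common
   value that is compatible with the lengths of all links. *)
Definition base_pot (u : G) (b : shrub_base) : nat :=
  match b with
  | inl (inl v) => if v == u then 0 else shrub_dist u v
  | inl (inr v) => if v == u then 2 else shrub_dist u v - 2
  | inr h => if val h \in nbrs (g u) then 2 + link_length u (val h) else 24 * k + 8
  end.

Lemma base_pot_edge u e :
  base_pot u (shrub_src e) <= base_pot u (shrub_dst e) + (shrub_len e).+1 /\
  base_pot u (shrub_dst e) <= base_pot u (shrub_src e) + (shrub_len e).+1.
Proof.
case: e => [v|[[[v h] b] vh]] /=; last rewrite /= in vh.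
  by case: eqP => _; rewrite ?/shrub_dist; lia.
rewrite prednK; last by rewrite (leq_trans _ (link_length_ge _ _)) // addn2.
move: (sval h) vh => {}h vh.
have [vu|vu] := eqVneq v u; first by rewrite -vu vh; lia.
rewrite /shrub_dist; have [[dM dmax]] := domP u v; have [ud vd] := setIP dM.
have := (link_length_ge u (dom u v), link_length_ge v (dom u v), link_length_ge u
  h, link_length_ge v h).
move=> [[[l1 l2] l3] l4]; have := (link_length_le u (dom u v), link_length_le v
  (dom u v), link_length_le u h, link_length_le v h).
(* If [h] is not adjacent to [u]: the values at centers other than that of [u] range from
   [16 * k + 6] to [24 * k + 8], so they differ from the value at [h] by at most [8 * k + 2], the
   least link length. *)
move=> [[[l5 l6] l7] l8]; case: ifP => [uh|_]; last by lia.
(* Among common hubs, the dominant one minimizes both link lengths. *)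
have hd : pi h <= pi (dom u v) by apply: dmax; apply/setIP.
have := link_length_mono uh ud hd; have := link_length_mono vh vd hd; lia.
Qed.

(** The walk through the dominant hub attains the value, and the potential based at [u] shows that
    no walk is shorter. *)
Lemma shrub_distP u v l : u != v ->
  has_dist (inl (pend u) : shrub) (inl (pend v)) l -> l = shrub_dist u v.
Proof.
move=> uv; apply: has_dist_eq.
  have [dM _] := domP u v; have [ud vd] := setIP dM.
  have -> : shrub_dist u v = 2 + (link_length u (dom u v) + link_length v (dom u
    v)) + 2.
    by rewrite /shrub_dist; lia.
  exact: walk_trans (walk_trans (walk_pend u) (walk_ctr ud vd)) (walk_sym
    (walk_pend v)).
move=> p pp lpv; pose pot := @sub_pot _ _ shrub_src shrub_dst shrub_len (base_pot u).
have lip : forall x y : shrub, edge x y -> pot y <= (pot x).+1.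
  by apply: sub_pot_edge => e; case: (base_pot_edge u e).
have := potential_path lip pp.
by rewrite lpv /pot /= eqxx (negbTE (_ : v != u)) // eq_sym.
Qed.

Lemma shrub_pendants :
  [set x : shrub | #|nbrs x| == 1] = [set inl (pend u) | u in [set: G]].
Proof.
have nbrs2 (x y z : shrub) : edge x y -> edge x z -> y != z -> (#|nbrs x| == 1) = false.
  move=> xy xz yz; apply/negbTE; rewrite neq_ltn; apply/orP; right.
  by apply/card_gt1P; exists y, z; rewrite !inE.
apply/setP => x; rewrite inE.
have notpend : (forall u, x != inl (pend u)) -> (x \in [set (inl (pend u) : shrub)
  | u in [set: G]]) = false.
  by move=> xn; apply/negbTE/imsetP => -[u _ xu]; have := xn u; rewrite xu eqxx.
case: x notpend => [[[u|u]|h]|[e j]] notpend.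
- rewrite imset_f // (_ : nbrs _ = [set first_interior shrub_src shrub_dst
  shrub_len_gt0 (inl u)]) ?cards1 //.
  apply/setP => y; rewrite !inE; apply/idP/eqP => [|->]; last exact: edge_first.
  case: y => [b|[[v|x] j]] //; rewrite [edge _ _]/= /sub_edge orbF =>
    /orP[] /andP[/eqP e] //.
  by case: e => vu _; subst v; congr (inr (existT _ _ _)); apply: val_inj;
    rewrite /= (ord1 j).
(* The pair [u], [u] has a dominant vertex, so every center has a link besides its pendant path. *)
- rewrite notpend //; have [h [hM _]] := dominant_ex pi common gT u u.
  have [uh _] := setIP hM.
  apply: nbrs2 (edge_last shrub_src shrub_dst shrub_len_gt0 (inl u))
               (edge_first shrub_src shrub_dst shrub_len_gt0 (inr (link_of uh true))) _.
  by apply/eqP.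
- rewrite notpend //; have /existsP[u uh] := valP h.
  have hE : hub_of uh = h by apply: val_inj.
  have := edge_last shrub_src shrub_dst shrub_len_gt0 (inr (link_of uh true)).
  have := edge_last shrub_src shrub_dst shrub_len_gt0 (inr (link_of uh false)).
  rewrite /= hE => e1 e2; apply: nbrs2 e1 e2 _.
  by apply/eqP.
rewrite notpend //; apply/negbTE; rewrite neq_ltn; apply/orP; right.
by apply: interior_nbrs; case: e {j notpend} => [u|x] /=; apply/eqP.
Qed.

Definition shrub_signature : {set 'I_1 * 'I_1 * 'I_(4 * (12 * k + 3)).+1} :=
  [set x | odd (nat_of_ord x.2)./2].

Lemma shrub_of_lacon : shrub_decomposition shrub shrub_signature G.
Proof.
split; [|by move=> i j l; rewrite !inE|exact: shrub_diam|].
  by move=> i j l; rewrite inE /=; case: (nat_of_ord l).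
exists (fun u => inl (pend u)), (fun=> ord0); split.
  by split; [move=> u v [] | rewrite shrub_pendants].
(* Equal vertices have distance zero, whose half is even, in accordance with irreflexivity. *)
move=> u v l; have [->|uv] := eqVneq u v.
  case=> _ /(_ [::]) l0; rewrite edge_irr inE /=.
  have : nat_of_ord l <= 0 by apply: l0; rewrite /is_path /= eqxx.
  by rewrite leqn0 => /eqP->.
move/(shrub_distP uv) => lE; have [hM hmax] := domP u v; have [ud vd] := setIP hM.
by rewrite inE /= lE /shrub_dist link_length_odd // (dom_edge uv (conj hM hmax)).
Qed.

Definition owner (e : G + link) : G := match e with inl u => u | inr x =>
  (val x).1.1 end.

(** Contracting pendant paths and link interiors onto the target that owns them is a weak
    homomorphism to the lacon, as [col_weak_hom] requires. *)
Definition shrub_map (x : shrub) : L :=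
  match x with
  | inl (inl (inl u)) | inl (inl (inr u)) => g u
  | inl (inr h) => val h
  | inr (existT e _) => g (owner e)
  end.

(** One pendant path, and two links for each of at most [k] neighbors. *)
Lemma owner_card z : #|[set e | g (owner e) == z]| <= 1 + 2 * k.
Proof.
have g_inj : injective g by case: gT.
have single : #|[set u | g u == z]| <= 1.
  rewrite -(card_imset _ g_inj) -(cards1 z) subset_leq_card //.
  by apply/subsetP => z' /imsetP[u]; rewrite !inE => /eqP-> ->.
have [[u /eqP gu]|none] := altP (existsP (P := fun u => g u == z)); last first.
  rewrite (_ : [set e | _] = set0) ?cards0 //; apply/setP => e; rewrite !inE.
  by apply: contraNF none => ge; apply/existsP; exists (owner e).
have sub : [set e | g (owner e) == z] \subset
    [set inl u | u in [set u | g u == z]] :|: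
    [set inr x | x : link in [set x | (val x).1.1 == u]].
  apply/subsetP => -[v|x]; rewrite inE => /= ge; apply/setUP; [left|right].
    by apply/imsetP; exists v; rewrite ?inE.
  by apply/imsetP; exists x; rewrite ?inE // -(inj_eq g_inj) gu.
apply: leq_trans (subset_leq_card sub) _.
apply: leq_trans (leq_card_setU _ _) _; apply: leq_add.
  exact: leq_trans (leq_imset_card _ _) single.
apply: leq_trans (leq_imset_card _ _) _.
pose code (x : link) : L * bool := (val (val x).1.2, (val x).2).
rewrite -(@card_in_imset _ _ code) => [|[[[v h] b] vh] [[[v' h'] b'] vh']]; last first.
  rewrite !inE /= => /eqP vu /eqP vu' [/val_inj hh bb]; subst v v' h' b'.
  exact: val_inj.
apply: (@leq_trans #|setX (nbrs z) [set: bool]|); last first.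
  by rewrite cardsX cardsT card_bool mulnC -gu leq_mul2l nbr_card.
apply/subset_leq_card/subsetP => y /imsetP[[[[v h] b] vh]];
  rewrite inE => /= /eqP vu ->.
by subst v; rewrite in_setX -gu vh inE.
Qed.

(** At most one pendant vertex, one center and one hub, plus the interiors of the owned paths. *)
Lemma shrub_fibre z :
  #|[set x | (shrub_map x == z) && (nbrs x != set0)]| <=
    3 + (12 * k + 3) * (1 + 2 * k).
Proof.
have g_inj : injective g by case: gT.
have single (D : finType) (h : D -> L) (F : D -> shrub) : injective h ->
    #|[set F u | u in [set u | h u == z]]| <= 1.
  move=> h_inj; apply: leq_trans (leq_imset_card _ _) _.
  rewrite -(card_imset _ h_inj) -(cards1 z) subset_leq_card //.
  by apply/subsetP => z' /imsetP[u]; rewrite !inE => /eqP-> ->.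
pose inner e : {set shrub} := [set (inr (existT _ e j) : shrub) | j : 'I_(shrub_len e)].
have sub : [set x | (shrub_map x == z) && (nbrs x != set0)] \subset
    [set (inl (pend u) : shrub) | u in [set u | g u == z]] :|:
    [set (inl (ctr u) : shrub) | u in [set u | g u == z]] :|:
    [set (inl (inr h) : shrub) | h in [set h : hub | val h == z]] :|:
    \bigcup_(e in [set e | g (owner e) == z]) inner e.
  apply/subsetP => x; rewrite inE => /andP[+ _].
  case: x => [[[u|u]|h]|[e j]] /= xz; rewrite !in_setU.
  - by rewrite imset_f ?inE.
  - by rewrite (imset_f (fun u => inl (ctr u))) ?inE ?orbT.
  - by rewrite (imset_f (fun h => inl (inr h))) ?inE ?orbT.
  by apply/orP; right; apply/bigcupP; exists e; rewrite ?inE // imset_f.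
apply: leq_trans (subset_leq_card sub) _.
apply: leq_trans (leq_card_setU _ _) _; apply: leq_add.
  apply: leq_trans (leq_card_setU _ _) _; apply: (@leq_add _ _ 2);
    last exact/single/val_inj.
  by apply: leq_trans (leq_card_setU _ _) _; apply: (@leq_add _ _ 1 1); apply: single.
apply: leq_trans (card_bigcup_leq (C := 12 * k + 3) _) _ => [e _|].
  apply: leq_trans (leq_imset_card _ _) _; rewrite card_ord.
  case: e => [u|x] /=; first lia.
  exact: leq_trans (leq_pred _) (link_length_le _ _).
by rewrite leq_mul2l owner_card orbT.
Qed.

Lemma shrub_col r :
  col r (refine (fun v => pi (shrub_map v))) <=
    ((3 + (12 * k + 3) * (1 + 2 * k)) * f r).+1.
Proof.
apply: leq_trans (col_weak_hom (h := shrub_map) (piL := pi) _ _ _ shrub_fibre) _.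
- have half (x y : shrub) : sub_half shrub_src shrub_dst x y -> shrub_map x =
  shrub_map y \/ edge (shrub_map x) (shrub_map y).
    case: x y => [b|[e j]] [b'|[e' j']] //=.
      case/orP=> /andP[/eqP<- _]; case: e' {j'} => [u|x] /=; try by left.
      by right; rewrite edge_sym; have := valP x; rewrite inE.
    by case/andP=> /eqP ee _; subst e'; left.
  move=> x y; rewrite [edge _ _]/= /sub_edge => /orP[/half //|/half[->|e]];
    [by left|by right; rewrite edge_sym].
- by move=> x y /refine_mono.
by rewrite ltnS leq_mul2l colf orbT.
Qed.

End Shrub.

Lemma lacon_shrub (C : graph_class) :
  (exists f : nat -> nat, forall G : sgraph, C G ->
     exists (L : sgraph) (pi : L -> nat),
       lacon_decomposition pi G /\ forall r : nat, col r pi <= f r) ->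
  exists (d : nat) (S : {set 'I_1 * 'I_1 * 'I_d.+1}) (C' : graph_class),
    bounded_expansion C' /\
    forall G : sgraph, C G ->
      exists F : sgraph, C' F /\ shrub_decomposition F S G.
Proof.
case=> f Cf; pose F r := ((3 + (12 * f 1 + 3) * (1 + 2 * f 1)) * f r).+1.
exists (4 * (12 * f 1 + 3)), (shrub_signature f).
exists (fun P : sgraph => exists2 pi : P -> nat, injective pi & forall r, col r pi
  <= F r).
split; first by exists F.
move=> G /Cf[L [pi [[T [label [g [[bipL pi_inj hid_lt common] [gT dom_edge]]]]] colf]]].
exists (shrub pi label g f); split;
  last exact: shrub_of_lacon bipL pi_inj hid_lt common gT dom_edge colf.
exists (refine (fun v => pi (shrub_map v))); first exact: refine_inj.
exact: shrub_col bipL hid_lt gT colf.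
Qed.

Theorem theorem6 (C : graph_class) :
  [<-> structurally_bounded_expansion C;
       exists f : nat -> nat, forall G : sgraph, C G ->
         exists (L : sgraph) (pi : L -> nat),
           lacon_decomposition pi G /\ forall r : nat, col r pi <= f r;
       exists (d : nat) (S : {set 'I_1 * 'I_1 * 'I_d.+1}) (C' : graph_class),
         bounded_expansion C' /\
         forall G : sgraph, C G ->
           exists F : sgraph, C' F /\ shrub_decomposition F S G;
       exists (d : nat) (C' : graph_class),
         bounded_expansion C' /\
         forall G : sgraph, C G ->
           exists P : sgraph, C' P /\ parity_decomposition d P G].
Proof.
tfae.
- exact: sbe_lacon.
- exact: lacon_shrub.
(* From shrubs to parities the way leads back through a transduction and a lacon-decomposition. *)
- by move=> /shrub_sbe/sbe_lacon/lacon_parity.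
- exact: parity_sbe.
Qed.
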